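(* Let $p$ be a prime and let $G$ be a finite $p$-group with $d(G)=3$, $\Phi(G)\le Z(G)$ and $G'\cong C_p^3$. Suppose the type of $G/G'$ is $(p^{m_1},p^{m_2},p^{m_3})$ with $m_1>m_2=m_3$, and $m_2>1$ if $p=2$. Then one can choose suitable (characteristic) generators of $G$ such that the characteristic matrix of $G$ is one of the following matrices, and different matrices give non-isomorphic groups. Here $\nu\in\{1,\eta\}$, $t\in F_p$ with $t\ne0$, and $r\in\{1,2,\dots,p-2\}$. (1) For odd $p$: (D1) $e_{11}+e_{23}-e_{32}$; (D2) $e_{11}+\nu e_{22}+e_{23}-e_{32}$; (D3) $e_{11}+e_{22}+\nu e_{33}$; (D4) $e_{11}+e_{22}+e_{23}-e_{32}+re_{33}$; (E1) $e_{23}-e_{32}$; (E2) $e_{22}+e_{23}-e_{32}$; (E3) $e_{22}+\nu e_{33}$; (E4) $e_{22}+e_{23}-e_{32}+re_{33}$. (2) For $p=2$: (D5) $e_{11}+e_{23}+e_{32}$; (D6) $e_{11}+e_{22}+e_{33}$; (D7) $e_{11}+e_{22}+e_{32}+e_{33}$; (E5) $e_{23}+e_{32}$; (E6) $e_{22}+e_{33}$; (E7) $e_{22}+e_{32}+e_{33}$. (3) For both odd $p$ and $p=2$: (D8) $e_{13}+e_{22}+te_{31}$; (D9) $e_{13}+e_{21}+e_{32}$; (E8) $e_{11}+e_{23}$; (E9) $e_{11}+\nu e_{33}$; (E10) $e_{23}+e_{31}$; (E11) $e_{21}+e_{33}$; (E12) $e_{13}+e_{22}$; (E13) $e_{13}+e_{32}$;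 (E14) $e_{13}+e_{21}$; (E15) $e_{13}+te_{31}$; (F1) $e_{11}$; (F2) $e_{23}$; (F3) $e_{33}$; (F4) $e_{21}$; (F5) $0$; (F6) $e_{13}$.
   Context: $d(G)$ is the minimal number of generators of $G$, $\Phi(G)$ the Frattini subgroup, $G'$ the derived subgroup, $C_p^3$ the elementary abelian group of order $p^3$. $F_p$ is the field with $p$ elements. For odd $p$, $\eta$ is a fixed square non-residue modulo $p$; for $p=2$ parameters ranging over $\{1,\eta\}$ are equal to $1$. $e_{ij}$ (two indices) denotes the $3\times3$ matrix over $F_p$ with $1$ in position $(i,j)$ and $0$ elsewhere. Characteristic matrix: let $G$ be a finite $p$-group with $d(G)=3$, $\Phi(G)\le Z(G)$, $G'\cong C_p^3$, and $G/G'$ of type $(p^{m_1},p^{m_2},p^{m_3})$, $m_1\ge m_2\ge m_3\ge1$ (i.e. $G/G'\cong C_{p^{m_1}}\times C_{p^{m_2}}\times C_{p^{m_3}}$). Choose $a_1,a_2,a_3\in G$ with $G/G'=\langle a_1G'\rangle\times\langle a_2G'\rangle\times\langle a_3G'\rangle$, $o(a_iG')=p^{m_i}$. Then $G=\langle a_1,a_2,a_3\rangle$, and $G'=\langle x,y,z\rangle$ with $x=[a_2,a_3]$, $y=[a_3,a_1]$, $z=[a_1,a_2]$. Write $a_i^{p^{m_i}}=x^{w_{i1}}y^{w_{i2}}z^{w_{i3}}$ for $i=1,2,3$. The $3\times3$ matrix $w(G)=(w_{ij})$ over $F_p$ is called a characteristic matrix of $G$, and $a_1,a_2,a_3$ a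 set of characteristic generators about $w(G)$ (the matrix depends on the choice of generators). A characteristic matrix together with $p,m_1,m_2,m_3$ determines $G$ up to isomorphism. *)

(* Defs.v *)
From HB Require Import structures.
From mathcomp Require Import all_boot all_order all_algebra.
From mathcomp Require Import all_fingroup all_solvable.

Set Implicit Arguments.
Unset Strict Implicit.
Unset Printing Implicit Defensive.

Import GRing.Theory.
Local Open Scope group_scope.

(* Matrix indices are numbered from 1, as on paper. *)
Definition idx (i : nat) : 'I_3 := inord i.-1.

Definition e (p i j : nat) : 'M['F_p]_3 := delta_mx (idx i) (idx j).

(* Here 'm(G) is the minimal number of generators of G, and abelian_type lists
   the orders of the cyclic factors in decreasing order. *)
Definition standing (p m1 m2 m3 : nat) (gT : finGroupType) (G : {group gT}) :
    Prop :=
  [/\ p.-group G /\ 'm(G) = 3,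
      'Phi(G) \subset 'Z(G),
      p.-abelem G^`(1),
      #|G^`(1)| = (p ^ 3)%N
    & abelian_type (G / G^`(1)) = [:: (p ^ m1)%N; (p ^ m2)%N; (p ^ m3)%N]].

(* The exponents w i j : 'F_p are read as their representatives in
   {0, ..., p - 1}. *)
Definition characteristic_generators (p m1 m2 m3 : nat) (gT : finGroupType)
    (G : {group gT}) (w : 'M['F_p]_3) (a1 a2 a3 : gT) : Prop :=
  let bar := coset G^`(1) in
  let x := [~ a2, a3] in
  let y := [~ a3, a1] in
  let z := [~ a1, a2] in
  let row i := x ^+ w (idx i) (idx 1) * y ^+ w (idx i) (idx 2)
                 * z ^+ w (idx i) (idx 3) in
  [/\ [/\ a1 \in G, a2 \in G & a3 \in G],
      <[bar a1]> \x <[bar a2]> \x <[bar a3]> = G / G^`(1),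
      [/\ #[bar a1] = (p ^ m1)%N, #[bar a2] = (p ^ m2)%N
        & #[bar a3] = (p ^ m3)%N]
    & [/\ a1 ^+ (p ^ m1) = row 1%N, a2 ^+ (p ^ m2) = row 2%N
        & a3 ^+ (p ^ m3) = row 3%N]].

Definition characteristic_matrix (p m1 m2 m3 : nat) (gT : finGroupType)
    (G : {group gT}) (w : 'M['F_p]_3) : Prop :=
  exists a1 a2 a3 : gT, characteristic_generators m1 m2 m3 G w a1 a2 a3.

Local Open Scope ring_scope.

(* The range {1, eta}, which collapses to {1} when p = 2. *)
Definition nu_range (p : nat) (eta nu : 'F_p) : Prop :=
  nu = 1 \/ (odd p /\ nu = eta).

Inductive listed (p : nat) (eta : 'F_p) : 'M['F_p]_3 -> Prop :=
| mx_D1 of odd p : listed eta (e p 1 1 + e p 2 3 - e p 3 2)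
| mx_D2 nu of odd p & nu_range eta nu :
    listed eta (e p 1 1 + nu *: e p 2 2 + e p 2 3 - e p 3 2)
| mx_D3 nu of odd p & nu_range eta nu :
    listed eta (e p 1 1 + e p 2 2 + nu *: e p 3 3)
| mx_D4 (r : nat) of odd p & (1 <= r <= p - 2)%N :
    listed eta (e p 1 1 + e p 2 2 + e p 2 3 - e p 3 2 + r%:R *: e p 3 3)
| mx_E1 of odd p : listed eta (e p 2 3 - e p 3 2)
| mx_E2 of odd p : listed eta (e p 2 2 + e p 2 3 - e p 3 2)
| mx_E3 nu of odd p & nu_range eta nu : listed eta (e p 2 2 + nu *: e p 3 3)
| mx_E4 (r : nat) of odd p & (1 <= r <= p - 2)%N :
    listed eta (e p 2 2 + e p 2 3 - e p 3 2 + r%:R *: e p 3 3)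
| mx_D5 of p = 2%N : listed eta (e p 1 1 + e p 2 3 + e p 3 2)
| mx_D6 of p = 2%N : listed eta (e p 1 1 + e p 2 2 + e p 3 3)
| mx_D7 of p = 2%N : listed eta (e p 1 1 + e p 2 2 + e p 3 2 + e p 3 3)
| mx_E5 of p = 2%N : listed eta (e p 2 3 + e p 3 2)
| mx_E6 of p = 2%N : listed eta (e p 2 2 + e p 3 3)
| mx_E7 of p = 2%N : listed eta (e p 2 2 + e p 3 2 + e p 3 3)
| mx_D8 (t : 'F_p) of t != 0 : listed eta (e p 1 3 + e p 2 2 + t *: e p 3 1)
| mx_D9 : listed eta (e p 1 3 + e p 2 1 + e p 3 2)
| mx_E8 : listed eta (e p 1 1 + e p 2 3)
| mx_E9 nu of nu_range eta nu : listed eta (e p 1 1 + nu *: e p 3 3)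
| mx_E10 : listed eta (e p 2 3 + e p 3 1)
| mx_E11 : listed eta (e p 2 1 + e p 3 3)
| mx_E12 : listed eta (e p 1 3 + e p 2 2)
| mx_E13 : listed eta (e p 1 3 + e p 3 2)
| mx_E14 : listed eta (e p 1 3 + e p 2 1)
| mx_E15 (t : 'F_p) of t != 0 : listed eta (e p 1 3 + t *: e p 3 1)
| mx_F1 : listed eta (e p 1 1)
| mx_F2 : listed eta (e p 2 3)
| mx_F3 : listed eta (e p 3 3)
| mx_F4 : listed eta (e p 2 1)
| mx_F5 : listed eta 0
| mx_F6 : listed eta (e p 1 3).

(* Main.v *)
(* Write w in blocks [[a, u], [v, M]] of sizes 1 + 2.  Since m1 > m2 = m3, a change
   of generators with coefficients s, B (invertible 2 x 2), c and k replaces w by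
   (s det B)^-1 [[s, 0], [k, B]] w [[s, 0], [c, B^T]], where k and c are arbitrary;
   hence characteristic matrices of isomorphic groups are exactly those in one
   orbit of this action.  If u <> 0, one normalises u = (0, 1), kills a with c and
   the second column of M with k, and a triangular group is left.  If u = 0 and
   a <> 0, one normalises a = 1, kills v with k, and M is left up to congruence.
   If u = a = 0, M is left up to congruence and scaling, and v modulo the image
   of M.  Congruence classes of 2 x 2 matrices are found by fixing the
   antisymmetric part and diagonalising the symmetric part over SL2.  Every matrix
   w occurs: take the central extension of the product of the cyclic groups by F_p^3
   given by the carry cocycles, weighted by the rows of w, plus a bilinear map. *)

Require Import Defs.
From HB Require Import structures.
From mathcomp Require Import all_boot all_order all_algebra.
From mathcomp Require Import all_fingroup all_solvable.
From mathcomp Require Import ring.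

Set Implicit Arguments.
Unset Strict Implicit.
Unset Printing Implicit Defensive.
Import GRing.Theory.

(** * Characteristic matrices under change of generators *)

(** The action has this shape because a change of generators is seen in two ways. Powers are
    additive in the generators, so the rows of w are multiplied on the left by a matrix Y. The
    commutators x, y, z form the second exterior power of the generators, so they change by the
    cofactor matrix K. Comparing the two gives w' K = Y w. If Z is the transposed change of
    generators, then K Z = s det B, which moves Z to the right of w and produces the factor (s det
    B)^-1. Additivity of the power map requires p to divide C(p^m, 2); for p = 2 this is the
    assumption m2 > 1. The classification of matrices is carried out over an abstract field with a
    parity flag. Only a few facts about squares are assumed there, so odd p and p = 2 share one list
    of forms. Of the relation between matrices only reflexivity and transitivity are needed:
    existence composes reductions, and uniqueness reads the entries off the equations. *)

Section Mk.
Local Open Scope ring_scope.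
Variable R : comNzRingType.

(** With nine explicit entries, matrix identities are settled entry by entry with [ring]. *)
Definition mk (a b c d e f g h k : R) : 'M[R]_3 :=
  \matrix_(i, j) nth 0 (nth [::] [:: [:: a; b; c]; [:: d; e; f]; [:: g; h; k]] i) j.

Lemma mk_eta (w : 'M[R]_3) :
  w = mk (w (idx 1) (idx 1)) (w (idx 1) (idx 2)) (w (idx 1) (idx 3))
         (w (idx 2) (idx 1)) (w (idx 2) (idx 2)) (w (idx 2) (idx 3))
         (w (idx 3) (idx 1)) (w (idx 3) (idx 2)) (w (idx 3) (idx 3)).
Proof.
by apply/matrixP=> [[[|[|[|//]]] ?] [[|[|[|//]]] ?]]; rewrite !mxE /=;
   congr (w _ _); apply/val_inj; rewrite /= inordK.
Qed.

Lemma mk_inj a b c d e f g h k a' b' c' d' e' f' g' h' k' :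
  mk a b c d e f g h k = mk a' b' c' d' e' f' g' h' k' ->
  [/\ [/\ a = a', b = b' & c = c'], [/\ d = d', e = e' & f = f']
    & [/\ g = g', h = h' & k = k']].
Proof.
move=> /matrixP E.
pose o n (n3 : (n < 3)%N) : 'I_3 := Ordinal n3.
have := (E (o 0 isT) (o 0 isT), E (o 0 isT) (o 1 isT), E (o 0 isT) (o 2 isT),
  E (o 1 isT) (o 0 isT), E (o 1 isT) (o 1 isT), E (o 1 isT) (o 2 isT),
  E (o 2 isT) (o 0 isT), E (o 2 isT) (o 1 isT), E (o 2 isT) (o 2 isT)).
by rewrite !mxE /= => -[[[[[[[[-> ->] ->] ->] ->] ->] ->] ->] ->].
Qed.

Lemma mk_mul a b c d e f g h k a' b' c' d' e' f' g' h' k' :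
  mk a b c d e f g h k *m mk a' b' c' d' e' f' g' h' k' =
  mk (a * a' + b * d' + c * g') (a * b' + b * e' + c * h') (a * c' + b * f' + c * k')
     (d * a' + e * d' + f * g') (d * b' + e * e' + f * h') (d * c' + e * f' + f * k')
     (g * a' + h * d' + k * g') (g * b' + h * e' + k * h') (g * c' + h * f' + k * k').
Proof.
by apply/matrixP=> [[[|[|[|//]]] ?] [[|[|[|//]]] ?]];
   rewrite !mxE !big_ord_recl big_ord0 !mxE /= addr0 addrA.
Qed.

Lemma mk_scale x a b c d e f g h k :
  x *: mk a b c d e f g h k =
  mk (x * a) (x * b) (x * c) (x * d) (x * e) (x * f) (x * g) (x * h) (x * k).
Proof. by apply/matrixP=> [[[|[|[|//]]] ?] [[|[|[|//]]] ?]]; rewrite !mxE. Qed.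

Lemma mk_add a b c d e f g h k a' b' c' d' e' f' g' h' k' :
  mk a b c d e f g h k + mk a' b' c' d' e' f' g' h' k' =
  mk (a + a') (b + b') (c + c') (d + d') (e + e') (f + f') (g + g') (h + h') (k + k').
Proof. by apply/matrixP=> [[[|[|[|//]]] ?] [[|[|[|//]]] ?]]; rewrite !mxE. Qed.

Lemma mk_scalar (x : R) : x%:M = mk x 0 0 0 x 0 0 0 x.
Proof. by apply/matrixP=> [[[|[|[|//]]] ?] [[|[|[|//]]] ?]]; rewrite !mxE. Qed.

Lemma mk0 : 0 = mk 0 0 0 0 0 0 0 0 (0 : R).
Proof. by apply/matrixP=> [[[|[|[|//]]] ?] [[|[|[|//]]] ?]]; rewrite !mxE. Qed.

Lemma mk_opp a b c d e f g h k :
  - mk a b c d e f g h k = mk (- a) (- b) (- c) (- d) (- e) (- f) (- g) (- h) (- k).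
Proof. by apply/matrixP=> [[[|[|[|//]]] ?] [[|[|[|//]]] ?]]; rewrite !mxE. Qed.

End Mk.

Section Relation.
Local Open Scope ring_scope.
Variable F : fieldType.
Implicit Types (w : 'M[F]_3).

(* The generators a1^s a2^c1 a3^c2, a1^(p^(m1-m2) ki) a2^bi1 a3^bi2 (i = 1, 2)
   have the characteristic matrix w'; the ki are unrelated to the cj because
   a1^(p^(m1-m2)) is trivial modulo the Frattini subgroup. *)
Definition mxrel (w w' : 'M[F]_3) : Prop :=
  exists s b11 b12 b21 b22 k1 k2 c1 c2 : F,
    [/\ s != 0, b11 * b22 - b12 * b21 != 0
      & (s * (b11 * b22 - b12 * b21)) *: w' =
        mk s 0 0 k1 b11 b12 k2 b21 b22 *m w *m mk s 0 0 c1 b11 b21 c2 b12 b22].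

Lemma mxrel_refl w : mxrel w w.
Proof.
exists 1, 1, 0, 0, 1, 0, 0, 0, 0; rewrite !mul1r mul0r subr0 oner_eq0; split=> //.
by rewrite -mk_scalar scale1r mul1mx mulmx1.
Qed.

Lemma mxrel_trans w1 w2 w3 : mxrel w1 w2 -> mxrel w2 w3 -> mxrel w1 w3.
Proof.
move=> [s [b11 [b12 [b21 [b22 [k1 [k2 [c1 [c2 [s0 d0 E]]]]]]]]]].
move=> [s' [b11' [b12' [b21' [b22' [k1' [k2' [c1' [c2' [s0' d0' E']]]]]]]]]].
(* These are the entries of the product of the two left factors (second times first) and of the two
   right factors (first times second); the 2 x 2 blocks stay transposes of each other. *)
exists (s' * s), (b11' * b11 + b12' * b21), (b11' * b12 + b12' * b22),
  (b21' * b11 + b22' * b21), (b21' * b12 + b22' * b22),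
  (k1' * s + b11' * k1 + b12' * k2), (k2' * s + b21' * k1 + b22' * k2),
  (c1 * s' + b11 * c1' + b21 * c2'), (c2 * s' + b12 * c1' + b22 * c2').
set D := _ - _.
have DE : D = (b11' * b22' - b12' * b21') * (b11 * b22 - b12 * b21) by rewrite /D; ring.
split; rewrite ?DE ?mulf_neq0 //.
transitivity ((s * (b11 * b22 - b12 * b21)) *: ((s' * (b11' * b22' - b12' * b21')) *: w3)).
  by rewrite scalerA; congr (_ *: _); ring.
rewrite E' scalemxAl scalemxAr E !mulmxA mk_mul -!mulmxA mk_mul !mulmxA.
by congr (mk _ _ _ _ _ _ _ _ _ *m _ *m mk _ _ _ _ _ _ _ _ _); ring.
Qed.

Definition bil (m11 m12 m21 m22 x1 x2 y1 y2 : F) :=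
  x1 * m11 * y1 + x1 * m12 * y2 + x2 * m21 * y1 + x2 * m22 * y2.

(** The first row of the left factor is (s, 0, 0), so one factor s has been cancelled in the
    equations for a', u1' and u2'. *)
Lemma mxrelE a u1 u2 v1 m11 m12 v2 m21 m22 a' u1' u2' v1' m11' m12' v2' m21' m22' :
  mxrel (mk a u1 u2 v1 m11 m12 v2 m21 m22)
        (mk a' u1' u2' v1' m11' m12' v2' m21' m22') <->
  exists s b11 b12 b21 b22 k1 k2 c1 c2 : F,
    let d := b11 * b22 - b12 * b21 in
    [/\ s != 0 /\ d != 0,
     [/\ d * a' = s * a + (u1 * c1 + u2 * c2),
         d * u1' = u1 * b11 + u2 * b12 & d * u2' = u1 * b21 + u2 * b22],
     (s * d * v1' = s * (k1 * a + b11 * v1 + b12 * v2)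
                 + k1 * (u1 * c1 + u2 * c2) + bil m11 m12 m21 m22 b11 b12 c1 c2) /\
     (s * d * v2' = s * (k2 * a + b21 * v1 + b22 * v2)
                 + k2 * (u1 * c1 + u2 * c2) + bil m11 m12 m21 m22 b21 b22 c1 c2),
     (s * d * m11' = k1 * (u1 * b11 + u2 * b12) + bil m11 m12 m21 m22 b11 b12 b11 b12) /\
     (s * d * m12' = k1 * (u1 * b21 + u2 * b22) + bil m11 m12 m21 m22 b11 b12 b21 b22)
   & (s * d * m21' = k2 * (u1 * b11 + u2 * b12) + bil m11 m12 m21 m22 b21 b22 b11 b12) /\
     (s * d * m22' = k2 * (u1 * b21 + u2 * b22) + bil m11 m12 m21 m22 b21 b22 b21 b22)].
Proof.
split=> -[s [b11 [b12 [b21 [b22 [k1 [k2 [c1 [c2 H]]]]]]]]];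
  exists s, b11, b12, b21, b22, k1, k2, c1, c2.
- case: H => s0 d0; rewrite !mk_mul mk_scale => /mk_inj[[E1 E2 E3] [E4 E5 E6] [E7 E8 E9]].
  rewrite /bil; split=> //; last 3 first.
  + by split; rewrite ?(E4, E7); ring.
  + by split; rewrite ?(E5, E6); ring.
  + by split; rewrite ?(E8, E9); ring.
  + by split; apply: (mulfI s0); rewrite mulrA ?(E1, E2, E3); ring.
- case: H => /= [[s0 d0] [E1 E2 E3] [E4 E7] [E5 E6] [E8 E9]]; split=> //.
  rewrite !mk_mul mk_scale E4 E5 E6 E7 E8 E9 -!mulrA E1 E2 E3 /bil.
  by congr mk; ring.
Qed.

End Relation.

(** * Congruence of 2 x 2 matrices *)

Local Ltac rsimp := rewrite ?(mul0r, mulr0, mul1r, mulr1, add0r, addr0, subr0, sub0r,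
  mulrN, mulNr, opprK, subrr, oppr0, expr0n, expr1n).
Local Ltac split_eq0 :=
  rewrite ?[0 == _]eq_sym ?oppr_eq0 ?mulf_eq0 ?expf_eq0 ?oppr_eq0.

Section Congruence.
Local Open Scope ring_scope.
Variables (F : fieldType) (isodd : bool) (eta : F).

Definition nu_ok (nu : F) := nu = 1 \/ (isodd /\ nu = eta).

(* Representatives (m11, m12, m21, m22) of the congruence classes of 2 x 2
   matrices; AltDiag with r = -1 would have rank one and be congruent to Nilp. *)
Inductive form2 : F -> F -> F -> F -> Prop :=
| Alt of isodd : form2 0 1 (-1) 0
| AltRank1 nu of isodd & nu_ok nu : form2 nu 1 (-1) 0
| SymDiag nu of isodd & nu_ok nu : form2 1 0 0 nu
| AltDiag r of isodd & r != 0 & r != -1 : form2 1 1 (-1) r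
| Alt2 of ~~ isodd : form2 0 1 1 0
| Diag2 of ~~ isodd : form2 1 0 0 1
| Asym2 of ~~ isodd : form2 1 0 1 1
| Nilp : form2 0 1 0 0
| SymRank1 nu of nu_ok nu : form2 0 0 0 nu
| Zero2 : form2 0 0 0 0.

(** These are the facts about F_p on which the classification rests: in the even case the field is
    F_2, [sq_class] says that 1 and eta represent all square classes, and [rep1] that a
    nondegenerate diagonal binary form takes the value 1. *)
Hypothesis two_neq0 : isodd -> 2%:R != 0 :> F.
Hypothesis even_F2 : ~~ isodd -> 1 + 1 = 0 :> F /\ forall x : F, x = 0 \/ x = 1.
Hypothesis eta_ns : isodd -> forall s : F, s ^+ 2 != eta.
Hypothesis sq_class : forall x : F, x != 0 ->
  exists s nu, [/\ s != 0, nu_ok nu & x = nu * s ^+ 2].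
Hypothesis rep1 : isodd -> forall x y : F, x != 0 -> y != 0 ->
  exists s t, x * s ^+ 2 + y * t ^+ 2 = 1.

(* N = t C M C^T with C invertible. *)
Definition congr2 (t m11 m12 m21 m22 n11 n12 n21 n22 : F) :=
  exists c11 c12 c21 c22, c11 * c22 - c12 * c21 != 0 /\
   [/\ n11 = t * bil m11 m12 m21 m22 c11 c12 c11 c12,
       n12 = t * bil m11 m12 m21 m22 c11 c12 c21 c22,
       n21 = t * bil m11 m12 m21 m22 c21 c22 c11 c12
     & n22 = t * bil m11 m12 m21 m22 c21 c22 c21 c22].

Lemma nu_ok_neq0 nu : nu_ok nu -> nu != 0.
Proof.
case=> [->|[od ->]]; first exact: oner_neq0.
by have := eta_ns od 0; rewrite expr0n /= eq_sym.
Qed.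

Lemma nu_ok_inj s nu nu' : nu_ok nu -> nu_ok nu' -> s != 0 -> nu' = nu * s ^+ 2 -> nu = nu'.
Proof.
move=> [->|[o ->]] [->|[o' ->]] s0 // E.
  by have := eta_ns o' s; rewrite E mul1r eqxx.
case/eqP: (eta_ns o s^-1); have s20 : s ^+ 2 != 0 by rewrite expf_neq0.
by apply: (mulIf s20); rewrite -E exprVn mulVf.
Qed.

(* The antisymmetric part of t C M C^T is multiplied by u = t det C and its
   determinant by u^2; this separates all but the few pairs of forms treated
   one by one.  The second alternative on t forces the parameter nu of the
   rank one forms to be 1, as it is lost when scaling is allowed. *)
Lemma form2_uniq t m11 m12 m21 m22 n11 n12 n21 n22 :
  t != 0 ->
  t = 1 \/
  (((m11 = 0 \/ m11 = 1) /\ (m11 = 0 -> m22 = 0 \/ m22 = 1)) /\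
   ((n11 = 0 \/ n11 = 1) /\ (n11 = 0 -> n22 = 0 \/ n22 = 1))) ->
  form2 m11 m12 m21 m22 -> form2 n11 n12 n21 n22 ->
  congr2 t m11 m12 m21 m22 n11 n12 n21 n22 ->
  [/\ m11 = n11, m12 = n12, m21 = n21 & m22 = n22].
Proof.
move=> t0 Ht Hm Hn [c11 [c12 [c21 [c22 [d0 [E1 E2 E3 E4]]]]]].
set d := _ - _ in d0; have td0 : t * d != 0 by rewrite mulf_neq0.
have Ea : n12 - n21 = (t * d) * (m12 - m21) by rewrite E2 E3 /bil /d; ring.
have Ed : n11 * n22 - n12 * n21 = (t * d) ^+ 2 * (m11 * m22 - m12 * m21).
  by rewrite E1 E2 E3 E4 /bil /d; ring.
move: (t * d) td0 Ea Ed => u u0.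
have n10 : 1 <> 0 :> F by apply/eqP/oner_neq0.
have un0 : u <> 0 by apply/eqP.
have odN : isodd -> 1 + 1 <> 0 :> F by move=> /two_neq0/eqP.
have even1 : ~~ isodd -> 1 + 1 = 0 :> F by move=> /even_F2[].
have odN1 : isodd -> 1 + 1 != 0 :> F by move=> /two_neq0.
destruct Hm as [o|nu o N|nu o N|r o r0 r1|o|o|o| |nu N| ];
destruct Hn as [o'|nu' o' N'|nu' o' N'|r' o' r0' r1'|o'|o'|o'| |nu' N'| ];
  try (by rewrite o in o'); try (by rewrite o' in o); rsimp; move=> Ea Ed; try by split.
all: try (by case: n10).
all: try (by case: un0).
all: try (by case: (odN o)).
all: have u1 := negbTE u0.
all: have i1 := negbTE (oner_neq0 F).
all: try have o2 := negbTE (odN1 o).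
all: try have o2 := negbTE (odN1 o').
all: try have n1 := negbTE (nu_ok_neq0 N).
all: try have n1' := negbTE (nu_ok_neq0 N').
all: try by move/eqP: Ea; split_eq0; rewrite ?u1 ?i1 ?o2 /=.
all: try by move/eqP: Ed; split_eq0; rewrite ?u1 ?i1 ?n1 /=.
all: try by move/eqP: Ed; split_eq0; rewrite ?u1 ?i1 ?n1' /=.
all: try by move/eqP: Ed; split_eq0; rewrite ?u1 ?i1 /=.
all: try by move/eqP: Ea; rewrite ?oppr_eq0 ?[0 == _]eq_sym ?oppr_eq0 ?u1 ?i1.
(* If both forms have antisymmetric part [[0, 1], [-1, 0]], then [Ea] reads 1 + 1 = u (1 + 1), so u
   = 1 and the determinants agree. *)
all: try (have ue : u = 1 by apply: (mulIf (odN1 o)); rewrite mul1r).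
all: try rewrite ue ?expr1n ?mul1r in Ed.
all: try by case/negP: r0'; rewrite -(inj_eq (addIr 1)) Ed add0r.
all: try by case/negP: r0; rewrite -(inj_eq (addIr 1)) -Ed add0r.
all: try by case/negP: r1'; rewrite -(inj_eq (addIr 1)) Ed addNr.
(* The pairs left, in order: [Alt] with [AltRank1] both ways; [AltRank1], [SymDiag] and [AltDiag]
   each with itself; [AltDiag] with [Nilp]; [Alt2] with [Diag2] both ways; [SymRank1] with itself;
   [SymRank1] with [Zero2] both ways. *)
- by case/eqP: n1'; rewrite E1 /bil; ring.
- have c110 : c11 = 0.
    have /eqP : t * nu * c11 ^+ 2 = 0 by rewrite E1 /bil; ring.
    by rewrite !mulf_eq0 (negbTE t0) n1 /= orbb => /eqP.
  have c210 : c21 = 0.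
    have /eqP : t * nu * c21 ^+ 2 = 0 by rewrite E4 /bil; ring.
    by rewrite !mulf_eq0 (negbTE t0) n1 /= orbb => /eqP.
  by case/eqP: d0; rewrite /d c110 c210; ring.
- have c210 : c21 = 0.
    have /eqP : t * nu * c21 ^+ 2 = 0 by rewrite E4 /bil; ring.
    by rewrite !mulf_eq0 (negbTE t0) n1 /= orbb => /eqP.
  have c110 : c11 != 0 by apply: contraNneq d0 => z; rewrite /d c210 z; apply/eqP; ring.
  split=> //; case: Ht => [t1|[[[z|->] _] [[z'|->] _]]] //.
  + by apply: (nu_ok_inj N N' c110); rewrite E1 t1 /bil; ring.
  + by case/eqP: n1.
  + by case/eqP: n1.
  + by case/eqP: n1'.
- by split=> //; apply: (nu_ok_inj N N' u0); rewrite Ed mulrC.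
- by split=> //; apply: (addIr 1).
- by move/eqP: Ed; rewrite eq_sym mulf_eq0 expf_eq0 u1 /= addr_eq0 (negbTE r1).
- case: n10; rewrite E1; transitivity (t * (c11 * c12) * (1 + 1)); first by rewrite /bil; ring.
  by rewrite (even1 o) mulr0.
- case/eqP: d0; rewrite /d.
  have cE x y : 0 = t * bil 1 0 0 1 x y x y -> x = y.
    move=> E; apply/eqP; rewrite -subr_eq0.
    have /eqP: t * (x - y) ^+ 2 = 0.
      transitivity (t * bil 1 0 0 1 x y x y - (t * x * y) * (1 + 1)).
        by rewrite /bil; ring.
      by rewrite -E (even1 o); ring.
    by rewrite mulf_eq0 expf_eq0 (negbTE t0).
  by rewrite (cE _ _ E1) (cE _ _ E4); ring.
- have c120 : c12 = 0.
    have /eqP : t * nu * c12 ^+ 2 = 0 by rewrite E1 /bil; ring.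
    by rewrite !mulf_eq0 (negbTE t0) n1 /= orbb => /eqP.
  have c220 : c22 != 0 by apply: contraNneq d0 => z; rewrite /d c120 z; apply/eqP; ring.
  split=> //; case: Ht => [t1|[[_ H] [_ H']]].
    by apply: (nu_ok_inj N N' c220); rewrite E4 t1 /bil; ring.
  case: (H erefl) (H' erefl) => [z|->] [z'|->] //.
  + by case/eqP: n1.
  + by case/eqP: n1.
  + by case/eqP: n1'.
- have c0 x y : 0 = t * bil 0 0 0 nu x y x y -> y = 0.
    move=> E; have /eqP : t * nu * y ^+ 2 = 0 by rewrite E /bil; ring.
    by rewrite !mulf_eq0 (negbTE t0) n1 /= orbb => /eqP.
  by case/eqP: d0; rewrite /d (c0 _ _ E1) (c0 _ _ E4); ring.
- by case/eqP: n1'; rewrite E4 /bil; ring.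
Qed.

(** The triple x, y, z encodes the symmetric matrix [[x, y], [y, z]]. *)
Definition sl2_equiv (x y z x' y' z' : F) :=
  exists c11 c12 c21 c22, c11 * c22 - c12 * c21 = 1 /\
   [/\ x' = bil x y y z c11 c12 c11 c12, y' = bil x y y z c11 c12 c21 c22
     & z' = bil x y y z c21 c22 c21 c22].

Lemma sl2_equiv_trans x1 y1 z1 x2 y2 z2 x3 y3 z3 :
  sl2_equiv x1 y1 z1 x2 y2 z2 -> sl2_equiv x2 y2 z2 x3 y3 z3 ->
  sl2_equiv x1 y1 z1 x3 y3 z3.
Proof.
move=> [a [b [c [d [D1 [-> -> ->]]]]]] [a' [b' [c' [d' [D2 [-> -> ->]]]]]].
exists (a' * a + b' * c), (a' * b + b' * d), (c' * a + d' * c), (c' * b + d' * d).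
split; last by rewrite /bil; split; ring.
by rewrite -[RHS]mulr1 -{1}D1 -D2; ring.
Qed.

Lemma congr2_trans m11 m12 m21 m22 n11 n12 n21 n22 q11 q12 q21 q22 :
  congr2 1 m11 m12 m21 m22 n11 n12 n21 n22 ->
  congr2 1 n11 n12 n21 n22 q11 q12 q21 q22 ->
  congr2 1 m11 m12 m21 m22 q11 q12 q21 q22.
Proof.
move=> [a [b [c [d [D [-> -> -> ->]]]]]] [a' [b' [c' [d' [D' [-> -> -> ->]]]]]].
exists (a' * a + b' * c), (a' * b + b' * d), (c' * a + d' * c), (c' * b + d' * d).
split; last by rewrite /bil; split; ring.
have -> : (a' * a + b' * c) * (c' * b + d' * d) - (a' * b + b' * d) * (c' * a + d' * c)
  = (a' * d' - b' * c') * (a * d - b * c) by ring.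
exact: mulf_neq0.
Qed.

(* Over SL2 the antisymmetric part is fixed, so that normalising the symmetric
   part alone handles symmetric and non-symmetric matrices at once. *)
Lemma sl2_diag (o : isodd) x y z :
  exists x' z', sl2_equiv x y z x' 0 z' /\ (x' = 0 -> z' = 0).
Proof.
have diag u v w : u != 0 -> exists x' z', sl2_equiv u v w x' 0 z' /\ (x' = 0 -> z' = 0).
  move=> u0; exists u, (w - v ^+ 2 / u); split; last by move/eqP: u0.
  exists 1, 0, (- v / u), 1; rewrite /bil; split; first by ring.
  by split; field.
have [x0|] := eqVneq x 0; last exact: diag.
have [z0|] := eqVneq z 0.
  have [y0|y0] := eqVneq y 0.
    exists 0, 0; split=> //; exists 1, 0, 0, 1; rewrite x0 y0 z0 /bil.
    by split; [ring | split; ring].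
  (* For a hyperbolic form the vector (1, 1) has value 2 y, nonzero in the odd case, and serves as
     pivot. *)
  have [|x' [z' [E H]]] := diag (2%:R * y) y 0; first by rewrite mulf_neq0 ?two_neq0.
  exists x', z'; split=> //; apply: sl2_equiv_trans E; exists 1, 1, 0, 1.
  by rewrite x0 z0 /bil; split; [ring | split; ring].
move=> /(diag _ (- y) x)[x' [z' [E H]]].
exists x', z'; split=> //; apply: sl2_equiv_trans E; exists 0, 1, (-1), 0.
by rewrite /bil; split; [ring | split; ring].
Qed.

Lemma sl2_normal (o : isodd) x y z :
  [\/ sl2_equiv x y z 0 0 0,
      exists2 nu, nu_ok nu & sl2_equiv x y z nu 0 0
    | exists2 r, r != 0 & sl2_equiv x y z 1 0 r].
Proof.
have [x' [z' [E H]]] := sl2_diag o x y z.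
have [x0|x0] := eqVneq x' 0; first by move: E; rewrite H x0 //; constructor 1.
have [z0|z0] := eqVneq z' 0.
  constructor 2; have [s [nu [s0 N xE]]] := sq_class x0.
  exists nu => //; apply: sl2_equiv_trans E _; exists s^-1, 0, 0, s.
  by rewrite /bil xE z0; split; [field | split; field].
constructor 3; exists (x' * z'); first exact: mulf_neq0.
have [s [t st1]] := rep1 o x0 z0; apply: sl2_equiv_trans E _.
(* The row (s, t) has value 1. The second row is orthogonal to it and makes the determinant 1, so
   the last entry must be the determinant x' z' of the form. *)
exists s, t, (- z' * t), (x' * s); rewrite /bil; split; first by rewrite -st1; ring.
split; [by rewrite -st1; ring | by ring |].
by rewrite -[LHS]mulr1 -st1; ring.
Qed.

Lemma form2_exists m11 m12 m21 m22 :
  exists n11 n12 n21 n22, form2 n11 n12 n21 n22 /\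
    congr2 1 m11 m12 m21 m22 n11 n12 n21 n22.
Proof.
have [o|o] := boolP isodd; last first.
  have [e2 f2] := even_F2 o.
  have ok n11 n12 n21 n22 c11 c12 c21 c22 : form2 n11 n12 n21 n22 ->
    c11 * c22 - c12 * c21 != 0 -> 
   [/\ n11 = 1 * bil m11 m12 m21 m22 c11 c12 c11 c12,
       n12 = 1 * bil m11 m12 m21 m22 c11 c12 c21 c22,
       n21 = 1 * bil m11 m12 m21 m22 c21 c22 c11 c12
     & n22 = 1 * bil m11 m12 m21 m22 c21 c22 c21 c22] ->
    exists n11 n12 n21 n22, form2 n11 n12 n21 n22 /\
    congr2 1 m11 m12 m21 m22 n11 n12 n21 n22.
    by move=> H1 H2 H3; exists n11, n12, n21, n22; split=> //; exists c11, c12, c21, c22.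
  have nz1 := oner_neq0 F; have sr1 := SymRank1 (or_introl (erefl 1)).
  have N1 : -1 = 1 :> F by apply: (addIr 1); rewrite addNr e2.
  (* Over F_2 there are sixteen matrices, each reduced by an explicit C. *)
  case: (f2 m11) ok => -> ; case: (f2 m12) => ->; case: (f2 m21) => ->; case: (f2 m22) => -> ok.
  - by apply: (ok _ _ _ _ 1 0 0 1 Zero2); rewrite /bil; rsimp; rewrite ?e2 ?N1; rsimp.
  - by apply: (ok _ _ _ _ 1 0 0 1 sr1); rewrite /bil; rsimp; rewrite ?e2 ?N1; rsimp.
  - by apply: (ok _ _ _ _ 0 1 1 0 Nilp); rewrite /bil; rsimp; rewrite ?e2 ?N1; rsimp.
  - by apply: (ok _ _ _ _ 1 1 1 0 Nilp); rewrite /bil; rsimp; rewrite ?e2 ?N1; rsimp.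
  - by apply: (ok _ _ _ _ 1 0 0 1 Nilp); rewrite /bil; rsimp; rewrite ?e2 ?N1; rsimp.
  - by apply: (ok _ _ _ _ 1 0 1 1 Nilp); rewrite /bil; rsimp; rewrite ?e2 ?N1; rsimp.
  - by apply: (ok _ _ _ _ 1 0 0 1 (Alt2 o)); rewrite /bil; rsimp; rewrite ?e2 ?N1; rsimp.
  - by apply: (ok _ _ _ _ 0 1 1 1 (Diag2 o)); rewrite /bil; rsimp; rewrite ?e2 ?N1; rsimp.
  - by apply: (ok _ _ _ _ 0 1 1 0 sr1); rewrite /bil; rsimp; rewrite ?e2 ?N1; rsimp.
  - by apply: (ok _ _ _ _ 1 0 0 1 (Diag2 o)); rewrite /bil; rsimp; rewrite ?e2 ?N1; rsimp.
  - by apply: (ok _ _ _ _ 0 1 1 1 Nilp); rewrite /bil; rsimp; rewrite ?e2 ?N1; rsimp.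
  - by apply: (ok _ _ _ _ 1 0 0 1 (Asym2 o)); rewrite /bil; rsimp; rewrite ?e2 ?N1; rsimp.
  - by apply: (ok _ _ _ _ 1 1 0 1 Nilp); rewrite /bil; rsimp; rewrite ?e2 ?N1; rsimp.
  - by apply: (ok _ _ _ _ 0 1 1 0 (Asym2 o)); rewrite /bil; rsimp; rewrite ?e2 ?N1; rsimp.
  - by apply: (ok _ _ _ _ 1 0 1 1 (Diag2 o)); rewrite /bil; rsimp; rewrite ?e2 ?N1; rsimp.
  - by apply: (ok _ _ _ _ 1 1 0 1 sr1); rewrite /bil; rsimp; rewrite ?e2 ?N1; rsimp.
have [d0|d0] := eqVneq (m12 - m21) 0.
  move/eqP: d0; rewrite subr_eq0 => /eqP <-.
  case: (sl2_normal o m11 m12 m22) =>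
    [[c11 [c12 [c21 [c22 [D [E1 E2 E3]]]]]]
    |[nu N [c11 [c12 [c21 [c22 [D [E1 E2 E3]]]]]]]
    |[r r0 [c11 [c12 [c21 [c22 [D [E1 E2 E3]]]]]]]].
  - exists 0, 0, 0, 0; split; first exact: Zero2.
    exists c11, c12, c21, c22; rewrite D oner_neq0 !mul1r; split=> //; split=> //.
    by rewrite E2 /bil; ring.
  - exists 0, 0, 0, nu; split; first exact: SymRank1.
    exists c21, c22, c11, c12; rewrite !mul1r; split; last split=> //.
      have -> : c21 * c12 - c22 * c11 = - (c11 * c22 - c12 * c21) by ring.
      by rewrite D oppr_eq0 oner_neq0.
    by rewrite E2 /bil; ring.
  (* With no antisymmetric part to preserve, C may have any nonzero determinant, so dividing the
     second row by s replaces r by its square class. *)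
  - have [s [nu [s0 N rE]]] := sq_class r0.
    exists 1, 0, 0, nu; split; first exact: SymDiag.
    exists c11, c12, (c21 / s), (c22 / s); rewrite !mul1r; split.
      have -> : c11 * (c22 / s) - c12 * (c21 / s) = (c11 * c22 - c12 * c21) / s by ring.
      by rewrite D mul1r invr_neq0.
    have E0 : 0 / s = 0 :> F by rewrite mul0r.
    split=> //; try by rewrite -E0 E2 /bil; ring.
    apply: (mulIf (expf_neq0 2 s0)); rewrite -rE E3 /bil; field.
    exact: s0.
(* Scaling the first basis vector by 2 / d turns the antisymmetric part into [[0, 1], [-1, 0]] and
   the symmetric part into [[x, y], [y, m22]]. After that only SL2 may act. *)
set d := m12 - m21 in d0; pose x := 2%:R ^+ 2 / d ^+ 2 * m11; pose y := (m12 + m21) / d.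
have congrJ x' z' : sl2_equiv x y m22 x' 0 z' -> congr2 1 m11 m12 m21 m22 x' 1 (-1) z'.
  move=> [c11 [c12 [c21 [c22 [D [E1 E2 E3]]]]]].
  exists (c11 * (2%:R / d)), c12, (c21 * (2%:R / d)), c22; split.
    have -> : c11 * (2%:R / d) * c22 - c12 * (c21 * (2%:R / d)) =
      (c11 * c22 - c12 * c21) * (2%:R / d) by ring.
    by rewrite D mul1r mulf_neq0 ?invr_neq0 ?two_neq0.
  rewrite !mul1r; split.
  - by rewrite E1 /bil /x /y /d; field.
  - transitivity (bil x y y m22 c11 c12 c21 c22 + (c11 * c22 - c12 * c21)).
      by rewrite -E2 D add0r.
    by rewrite /bil /x /y /d; field.
  - transitivity (bil x y y m22 c11 c12 c21 c22 - (c11 * c22 - c12 * c21)).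
      by rewrite -E2 D add0r.
    by rewrite /bil /x /y /d; field.
  - by rewrite E3 /bil /x /y /d; field.
case: (sl2_normal o x y m22) => [/congrJ H|[nu N /congrJ H]|[r r0 /congrJ H]].
- by exists 0, 1, (-1), 0; split; first exact: Alt.
- by exists nu, 1, (-1), 0; split; first exact: AltRank1.
have [rN|rN] := eqVneq r (-1); last by exists 1, 1, (-1), r; split; first exact: AltDiag.
exists 0, 1, 0, 0; split; first exact: Nilp.
have t0 := two_neq0 o; apply: congr2_trans H _.
(* For r = -1 the matrix is the column (1, -1) times the row (1, 1). The rows of C form the basis
   dual to these two vectors. *)
exists (1 / 2%:R), (- 1 / 2%:R), (1 / 2%:R), (1 / 2%:R); split.
  by have -> : 1 / 2%:R * (1 / 2%:R) - -1 / 2%:R * (1 / 2%:R) = 1 / 2%:R :> F;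
    [field | rewrite mul1r invr_neq0].
by rewrite rN /bil; split; field.
Qed.

(** * Normal forms of 3 x 3 matrices under [mxrel] *)

Local Ltac fieldd := by split; field; do ?[apply/andP; split].
Local Ltac rewrel := rewrite /bil; split; [split | fieldd | fieldd | fieldd | fieldd].

(* In nfA, nfB, nfC the arguments are the rows (a, u), (v, M) of a 3 x 3 matrix:
   u = 0 and a = 1; u = 0 and a = 0; u = (0, 1) and a = 0. *)
Inductive nfA : F -> F -> F -> F -> F -> F -> F -> F -> F -> Prop :=
| NFA m11 m12 m21 m22 of form2 m11 m12 m21 m22 : nfA 1 0 0 0 m11 m12 0 m21 m22.

Inductive nfB : F -> F -> F -> F -> F -> F -> F -> F -> F -> Prop :=
| NFB_inv m11 m12 m21 m22 of form2 m11 m12 m21 m22 & m11 * m22 - m12 * m21 != 0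
    & m11 = 0 \/ m11 = 1 : nfB 0 0 0 0 m11 m12 0 m21 m22
| NFB_nilp x of x = 0 \/ x = 1 : nfB 0 0 0 0 0 1 x 0 0
| NFB_sym x of x = 0 \/ x = 1 : nfB 0 0 0 x 0 0 0 0 1
| NFB_zero x of x = 0 \/ x = 1 : nfB 0 0 0 x 0 0 0 0 0.

Inductive nfC : F -> F -> F -> F -> F -> F -> F -> F -> F -> Prop :=
| NFC1 t : nfC 0 0 1 0 1 0 t 0 0
| NFC2 x of x = 0 \/ x = 1 : nfC 0 0 1 x 0 0 0 1 0
| NFC3 : nfC 0 0 1 1 0 0 0 0 0
| NFC4 t : nfC 0 0 1 0 0 0 t 0 0.

Definition normal_form a u1 u2 v1 m11 m12 v2 m21 m22 :=
  [\/ nfA a u1 u2 v1 m11 m12 v2 m21 m22, nfB a u1 u2 v1 m11 m12 v2 m21 m22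
    | nfC a u1 u2 v1 m11 m12 v2 m21 m22].

Definition reducible (w : 'M[F]_3) := exists a u1 u2 v1 m11 m12 v2 m21 m22,
  normal_form a u1 u2 v1 m11 m12 v2 m21 m22 /\
  mxrel w (mk a u1 u2 v1 m11 m12 v2 m21 m22).

Lemma reducible_trans w w' : mxrel w w' -> reducible w' -> reducible w.
Proof.
move=> H [a [u1 [u2 [v1 [m11 [m12 [v2 [m21 [m22 [N R]]]]]]]]]].
by exists a, u1, u2, v1, m11, m12, v2, m21, m22; split; last exact: mxrel_trans R.
Qed.

Lemma reducible_nf a u1 u2 v1 m11 m12 v2 m21 m22 :
  normal_form a u1 u2 v1 m11 m12 v2 m21 m22 ->
  reducible (mk a u1 u2 v1 m11 m12 v2 m21 m22).
Proof.
by move=> N; exists a, u1, u2, v1, m11, m12, v2, m21, m22; split; last exact: mxrel_refl.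
Qed.

Lemma reducible_B_inv v1 v2 m11 m12 m21 m22 :
  form2 m11 m12 m21 m22 -> m11 * m22 - m12 * m21 != 0 -> m11 = 0 \/ m11 = 1 ->
  reducible (mk 0 0 0 v1 m11 m12 v2 m21 m22).
Proof.
move=> f D0 m01; apply: (@reducible_trans _ (mk 0 0 0 0 m11 m12 0 m21 m22)); last first.
  by apply: reducible_nf; constructor 2; constructor.
(* With s = 1 and B = 1 the new v is v + M c, so c = - M^-1 v, written by Cramer's rule. *)
apply/mxrelE; exists 1, 1, 0, 0, 1, 0, 0,
  (- (m22 * v1 - m12 * v2) / (m11 * m22 - m12 * m21)),
  (- (m11 * v2 - m21 * v1) / (m11 * m22 - m12 * m21)).
rewrel; first exact: oner_neq0.
by have -> : 1 * 1 - 0 * 0 = 1 :> F by [ring]; exact: oner_neq0.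
Qed.

(** The free scalar s d removes nu from [AltRank1] and [SymRank1], but not from [SymDiag]. As c
    moves v by the column space of M, something of v survives only for singular M, and a triangular
    B then makes it 0 or a basis vector. *)
Lemma reducible_B v1 v2 m11 m12 m21 m22 :
  form2 m11 m12 m21 m22 -> reducible (mk 0 0 0 v1 m11 m12 v2 m21 m22).
Proof.
have n1 := oner_neq0 F; have nN1 : -1 != 0 :> F by rewrite oppr_eq0.
case=> [o|nu o N|nu o N|r o r0 r1|o|o|o| |nu N| ].
- by apply: reducible_B_inv; [exact: Alt | rsimp | left].
- have nu0 := nu_ok_neq0 N.
  apply: (@reducible_trans _ (mk 0 0 0 v1 1 1 (nu * v2) (-1) 0)); last first.
    by apply: reducible_B_inv; [apply: AltRank1 => //; left | rsimp | right].
  apply/mxrelE; exists 1, nu^-1, 0, 0, 1, 0, 0, 0, 0; rewrel => //.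
  by have -> : nu^-1 * 1 - 0 * 0 = nu^-1 by [ring]; rewrite invr_neq0.
- by apply: reducible_B_inv; [exact: SymDiag | rsimp; exact: nu_ok_neq0 | right].
- apply: reducible_B_inv; [exact: AltDiag | rsimp | by right].
  by rewrite -[1]opprK subr_eq0.
- by apply: reducible_B_inv; [exact: Alt2 | rsimp | left].
- by apply: reducible_B_inv; [exact: Diag2 | rsimp | right].
- by apply: reducible_B_inv; [exact: Asym2 | rsimp | right].
- have [v20|v20] := eqVneq v2 0.
    apply: (@reducible_trans _ (mk 0 0 0 0 0 1 0 0 0)).
      apply/mxrelE; exists 1, 1, 0, 0, 1, 0, 0, 0, (- v1); rewrite v20.
      by rewrel => //; rewrite mulr1 mulr0 subr0.
    by apply: reducible_nf; constructor 2; constructor; left.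
  apply: (@reducible_trans _ (mk 0 0 0 0 0 1 1 0 0)).
    apply/mxrelE; exists 1, v2, 0, 0, 1, 0, 0, 0, (- v1).
    by rewrel => //; rewrite mulr1 mulr0 subr0.
  by apply: reducible_nf; constructor 2; constructor; right.
- have nu0 := nu_ok_neq0 N; have [v10|v10] := eqVneq v1 0.
    apply: (@reducible_trans _ (mk 0 0 0 0 0 0 0 0 1)).
      apply/mxrelE; exists nu, 1, 0, 0, 1, 0, 0, 0, (- v2); rewrite v10.
      by rewrel => //; rewrite mulr1 mulr0 subr0.
    by apply: reducible_nf; constructor 2; constructor; left.
  apply: (@reducible_trans _ (mk 0 0 0 1 0 0 0 0 1)).
    apply/mxrelE; exists nu, v1, 0, 0, v1, 0, 0, 0, (- v2).
    by rewrel => //; rewrite mulr0 subr0 mulf_neq0.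
  by apply: reducible_nf; constructor 2; constructor; right.
- have [v10|v10] := eqVneq v1 0.
    have [v20|v20] := eqVneq v2 0.
      by rewrite v10 v20; apply: reducible_nf; constructor 2; constructor; left.
    apply: (@reducible_trans _ (mk 0 0 0 1 0 0 0 0 0)).
      apply/mxrelE; exists 1, 0, 1, (- v2), 0, 0, 0, 0, 0; rewrite v10.
      by rewrel => //; rewrite mul0r sub0r mul1r opprK.
    by apply: reducible_nf; constructor 2; constructor; right.
  apply: (@reducible_trans _ (mk 0 0 0 1 0 0 0 0 0)).
    apply/mxrelE; exists 1, 1, 0, (- v2), v1, 0, 0, 0, 0.
    by rewrel => //; rewrite mul0r subr0 mul1r.
  by apply: reducible_nf; constructor 2; constructor; right.
Qed.

(** Preserving a = 0 and u = (0, 1) forces c2 = b12 = 0 and b11 = 1, and k only restores the zero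
    column of M. What remains is elimination on (v1, m11) and (v2, m21): subtract a multiple of the
    first row from the second, add a multiple of the M column to v, and rescale. *)
Lemma reducible_C v1 v2 m11 m21 : reducible (mk 0 0 1 v1 m11 0 v2 m21 0).
Proof.
have n1 := oner_neq0 F.
have [a0|a0] := eqVneq m11 0; last first.
  apply: (@reducible_trans _ (mk 0 0 1 0 1 0 (v2 - m21 * v1 / m11) 0 0)).
    apply/mxrelE; exists m11, 1, 0, (- m21 / m11), 1, m21, 0, (- v1), 0.
    by rewrel => //; rewrite mul0r subr0 mul1r.
  by apply: reducible_nf; constructor 3; constructor.
rewrite a0; have [b0|b0] := eqVneq m21 0; last first.
  have [v10|v10] := eqVneq v1 0.
    apply: (@reducible_trans _ (mk 0 0 1 0 0 0 0 1 0)).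
      apply/mxrelE; exists m21, 1, 0, 0, 1, 0, 0, (- v2), 0; rewrite v10.
      by rewrel => //; rewrite mul0r subr0 mul1r.
    by apply: reducible_nf; constructor 3; constructor; left.
  apply: (@reducible_trans _ (mk 0 0 1 1 0 0 0 1 0)).
    apply/mxrelE; exists m21, 1, 0, 0, v1, 0, 0, (- v2), 0.
    by rewrel => //; rewrite mul0r subr0 mul1r.
  by apply: reducible_nf; constructor 3; constructor; right.
rewrite b0; have [v10|v10] := eqVneq v1 0.
  by rewrite v10; apply: reducible_nf; constructor 3; constructor.
apply: (@reducible_trans _ (mk 0 0 1 1 0 0 0 0 0)).
  apply/mxrelE; exists 1, 1, 0, (- v2), v1, 0, 0, 0, 0.
  by rewrel => //; rewrite mul0r subr0 mul1r.
by apply: reducible_nf; constructor 3; constructor.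
Qed.

(** This is [mxrelE] solved for the second matrix, for reductions whose target is not known in
    advance. *)
Lemma mxrel_act (s b11 b12 b21 b22 k1 k2 c1 c2 a u1 u2 v1 m11 m12 v2 m21 m22 : F) :
  let d := b11 * b22 - b12 * b21 in s != 0 -> d != 0 ->
  mxrel (mk a u1 u2 v1 m11 m12 v2 m21 m22)
    (mk ((s * a + (u1 * c1 + u2 * c2)) / d)
        ((u1 * b11 + u2 * b12) / d) ((u1 * b21 + u2 * b22) / d)
        ((s * (k1 * a + b11 * v1 + b12 * v2) + k1 * (u1 * c1 + u2 * c2)
          + bil m11 m12 m21 m22 b11 b12 c1 c2) / (s * d))
        ((k1 * (u1 * b11 + u2 * b12) + bil m11 m12 m21 m22 b11 b12 b11 b12) / (s * d))
        ((k1 * (u1 * b21 + u2 * b22) + bil m11 m12 m21 m22 b11 b12 b21 b22) / (s * d))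
        ((s * (k2 * a + b21 * v1 + b22 * v2) + k2 * (u1 * c1 + u2 * c2)
          + bil m11 m12 m21 m22 b21 b22 c1 c2) / (s * d))
        ((k2 * (u1 * b11 + u2 * b12) + bil m11 m12 m21 m22 b21 b22 b11 b12) / (s * d))
        ((k2 * (u1 * b21 + u2 * b22) + bil m11 m12 m21 m22 b21 b22 b21 b22) / (s * d))).
Proof.
move=> d s0 d0; apply/mxrelE; exists s, b11, b12, b21, b22, k1, k2, c1, c2.
have divK (x y : F) : y != 0 -> y * (x / y) = x by move=> y0; rewrite mulrC divfK.
by rewrite -/d /= !divK ?mulf_neq0.
Qed.

Lemma reducible_u_neq0 a u1 u2 v1 m11 m12 v2 m21 m22 :
  (u1 != 0) || (u2 != 0) -> reducible (mk a u1 u2 v1 m11 m12 v2 m21 m22).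
Proof.
have n1 := oner_neq0 F; have d1 : 1 * 1 - 0 * 0 != 0 :> F by rewrite mul0r subr0 mul1r.
suff red01 a' v1' m11' m12' v2' m21' m22' :
    reducible (mk a' 0 1 v1' m11' m12' v2' m21' m22').
  (* The new u is u B^T / det B. The first row of B is (u2, -u1), orthogonal to u; the second is
     chosen so that its product with u equals det B. *)
  have [->|u20 _] := eqVneq u2 0.
    rewrite orbF => u10.
    have d0 : 0 * 0 - (- u1) * 1 != 0 by rewrite mul0r sub0r mulr1 opprK.
    apply: reducible_trans (mxrel_act 0 0 0 0 a u1 0 v1 m11 m12 v2 m21 m22 n1 d0) _.
    have -> : (u1 * 0 + 0 * - u1) / (0 * 0 - - u1 * 1) = 0 by rsimp.
    have -> : (u1 * 1 + 0 * 0) / (0 * 0 - - u1 * 1) = 1 by rsimp; exact: divff.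
    exact: red01.
  have d0 : u2 * 1 - (- u1) * 0 != 0 by rsimp.
  apply: reducible_trans (mxrel_act 0 0 0 0 a u1 u2 v1 m11 m12 v2 m21 m22 n1 d0) _.
  have -> : (u1 * u2 + u2 * - u1) / (u2 * 1 - - u1 * 0) = 0.
    by rewrite [u1 * u2]mulrC; rsimp.
  have -> : (u1 * 0 + u2 * 1) / (u2 * 1 - - u1 * 0) = 1 by rsimp; exact: divff.
  exact: red01.
apply: reducible_trans
  (mxrel_act (- m12') (- m22') 0 (- a') a' 0 1 v1' m11' m12' v2' m21' m22' n1 d1) _.
rewrite /bil; rsimp; rewrite ?invr1 !addNr.
by rsimp; exact: reducible_C.
Qed.

Lemma reducible_all a u1 u2 v1 m11 m12 v2 m21 m22 :
  reducible (mk a u1 u2 v1 m11 m12 v2 m21 m22).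
Proof.
have [u0|] := boolP ((u1 == 0) && (u2 == 0)); last first.
  by rewrite negb_and; apply: reducible_u_neq0.
case/andP: u0 => /eqP-> /eqP->; have [->|a0] := eqVneq a 0.
  have [n11 [n12 [n21 [n22 [f [c11 [c12 [c21 [c22 [d0 [E1 E2 E3 E4]]]]]]]]]]] :=
    form2_exists m11 m12 m21 m22.
  (* Taking s = 1 / det B makes the scalar s d equal to 1, so M undergoes a plain congruence. *)
  set d := _ - _ in d0; have di0 : d^-1 != 0 by rewrite invr_neq0.
  apply: reducible_trans (mxrel_act 0 0 0 0 0 0 0 v1 m11 m12 v2 m21 m22 di0 d0) _.
  move: f; rewrite E1 E2 E3 E4 -/d mulVf //; rsimp; rewrite ?divr1; exact: reducible_B.
(* Reaching a' = 1 forces det B = s a, and M becomes B M B^T / (s^2 a), which is a congruence of a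
   M. Hence a M, not M, is put in normal form. *)
have [n11 [n12 [n21 [n22 [f [c11 [c12 [c21 [c22 [d0 [E1 E2 E3 E4]]]]]]]]]]] :=
  form2_exists (a * m11) (a * m12) (a * m21) (a * m22).
set d := _ - _ in d0.
apply: reducible_trans (_ : mxrel _ (mk 1 0 0 0 n11 n12 0 n21 n22)) _.
  apply/mxrelE; exists (d * a)^-1, (c11 / d), (c12 / d), (c21 / d), (c22 / d),
    (- (c11 / d * v1 + c12 / d * v2) / a), (- (c21 / d * v1 + c22 / d * v2) / a), 0, 0.
  have dE : c11 / d * (c22 / d) - c12 / d * (c21 / d) = d^-1.
    transitivity ((c11 * c22 - c12 * c21) / d / d); first by ring.
    by rewrite -/d divff ?mul1r.
  rewrite dE E1 E2 E3 E4; clearbody d; rewrel.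
    by rewrite invr_neq0 ?mulf_neq0.
  by rewrite invr_neq0.
by apply: reducible_nf; constructor 1; constructor.
Qed.

Lemma nfA_form2 a u1 u2 v1 m11 m12 v2 m21 m22 :
  nfA a u1 u2 v1 m11 m12 v2 m21 m22 ->
  [/\ a = 1, u1 = 0 /\ u2 = 0, v1 = 0 /\ v2 = 0 & form2 m11 m12 m21 m22].
Proof. by case. Qed.

(** The last conjunct is the condition under which [form2_uniq] tolerates a scalar t other than
    1. *)
Lemma nfB_form2 a u1 u2 v1 m11 m12 v2 m21 m22 :
  nfB a u1 u2 v1 m11 m12 v2 m21 m22 ->
  [/\ a = 0, u1 = 0 /\ u2 = 0, form2 m11 m12 m21 m22
    & (m11 = 0 \/ m11 = 1) /\ (m11 = 0 -> m22 = 0 \/ m22 = 1)].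
Proof.
case=> [{}m11 {}m12 {}m21 {}m22 f D0 m01|x _|x _|x _]; do 3?split; try by [left|right].
- exact: f.
- exact: m01.
- have n1 : 1 <> 0 :> F by apply/eqP/oner_neq0.
  case: f D0 {m01} => [o|nu o N|nu o N|r o r0 r1|o|o|o| |nu N| ]; rsimp; move=> D0 z;
    by [left | case/eqP: D0 | case: n1].
- exact: Nilp.
- by apply: SymRank1; left.
- exact: Zero2.
Qed.

Lemma nfC_entries a u1 u2 v1 m11 m12 v2 m21 m22 :
  nfC a u1 u2 v1 m11 m12 v2 m21 m22 ->
  [/\ a = 0, u1 = 0 /\ u2 = 1 & m12 = 0 /\ m22 = 0].
Proof. by case. Qed.

Lemma nfA_uniq a u1 u2 v1 m11 m12 v2 m21 m22 a' u1' u2' v1' m11' m12' v2' m21' m22' :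
  nfA a u1 u2 v1 m11 m12 v2 m21 m22 ->
  nfA a' u1' u2' v1' m11' m12' v2' m21' m22' ->
  mxrel (mk a u1 u2 v1 m11 m12 v2 m21 m22)
        (mk a' u1' u2' v1' m11' m12' v2' m21' m22') ->
  mk a u1 u2 v1 m11 m12 v2 m21 m22 = mk a' u1' u2' v1' m11' m12' v2' m21' m22'.
Proof.
move=> [{}m11 {}m12 {}m21 {}m22 f] [{}m11' {}m12' {}m21' {}m22' f'].
move/mxrelE=> [s [b11 [b12 [b21 [b22 [k1 [k2 [c1 [c2 /=]]]]]]]]].
set d := _ - _; rsimp => -[[s0 d0] [ds _ _] _ [E1 E2] [E3 E4]].
(* As a = a' = 1, det B = s, and B / s is a congruence with scalar 1. *)
rewrite ds in E1 E2 E3 E4.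
suff: [/\ m11 = m11', m12 = m12', m21 = m21' & m22 = m22'] by case=> -> -> -> ->.
apply: (@form2_uniq 1) => //; [exact: oner_neq0 | by left |].
exists (b11 / s), (b12 / s), (b21 / s), (b22 / s); split.
  have -> : b11 / s * (b22 / s) - b12 / s * (b21 / s) = d / s / s by rewrite /d; ring.
  by rewrite ds divff // mul1r invr_neq0.
have ss0 : s * s != 0 by rewrite mulf_neq0.
by split; apply: (mulfI ss0); rewrite ?E1 ?E2 ?E3 ?E4 /bil; field.
Qed.

Lemma nfB_uniq a u1 u2 v1 m11 m12 v2 m21 m22 a' u1' u2' v1' m11' m12' v2' m21' m22' :
  nfB a u1 u2 v1 m11 m12 v2 m21 m22 ->
  nfB a' u1' u2' v1' m11' m12' v2' m21' m22' ->
  mxrel (mk a u1 u2 v1 m11 m12 v2 m21 m22)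
        (mk a' u1' u2' v1' m11' m12' v2' m21' m22') ->
  mk a u1 u2 v1 m11 m12 v2 m21 m22 = mk a' u1' u2' v1' m11' m12' v2' m21' m22'.
Proof.
move=> N N' /mxrelE [s [b11 [b12 [b21 [b22 [k1 [k2 [c1 [c2 /=]]]]]]]]].
have [a0 [u10 u20] f m01] := nfB_form2 N; have [a0' [u10' u20'] f' m01'] := nfB_form2 N'.
set d := _ - _; rewrite a0 u10 u20; rsimp => -[[s0 d0] _ [V1 V2] [E1 E2] [E3 E4]].
have sd0 : s * d != 0 by rewrite mulf_neq0.
have [] : [/\ m11 = m11', m12 = m12', m21 = m21' & m22 = m22'].
  apply: (@form2_uniq (s * d)^-1) => //; [by rewrite invr_neq0 | by right |].
  exists b11, b12, b21, b22; split=> //.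
  by rewrite -E1 -E2 -E3 -E4 !mulKf.
move=> M1 M2 M3 M4; have n1 : 1 <> 0 :> F by apply/eqP/oner_neq0.
(* Once M agrees, the remaining parameter x is 0 or 1, so it is enough that x and x' vanish
   together. *)
have bool_eq (x x' : F) : x = 0 \/ x = 1 -> x' = 0 \/ x' = 1 -> (x == 0) = (x' == 0) -> x = x'.
  by case=> ->; case=> -> //; rewrite eqxx oner_eq0.
clear f f' a0 u10 u20 a0' u10' u20' m01 m01'.
destruct N as [m11 m12 m21 m22 f D0 _|x Hx|x Hx|x Hx];
destruct N' as [m11' m12' m21' m22' f' D0' _|x' Hx'|x' Hx'|x' Hx'];
  first by rewrite M1 M2 M3 M4.
all: try by case/eqP: D0; rewrite M1 M2 M3 M4; ring.
all: try by case/eqP: D0'; rewrite -M1 -M2 -M3 -M4; ring.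
all: try by case: n1.
all: move: V1 V2 E1 E2 E3 E4; rewrite /bil; rsimp.
- move=> _ V2 E1 E2 E3 E4.
  have : b11 * b22 != 0 by rewrite -E2.
  rewrite mulf_eq0 negb_or => /andP[b110 b220].
  have b210 : b21 = 0 by apply: (mulIf b220); rewrite -E4 mul0r.
  move: V2; rewrite b210; rsimp => V2.
  suff -> : x = x' by [].
  apply: bool_eq => //; have := congr1 (fun z => z == 0) V2.
  by rewrite /= !mulf_eq0 (negbTE s0) (negbTE d0) (negbTE b220).
- move=> V1 _ E1 E2 E3 E4.
  have b120 : b12 = 0 by move/eqP: E1; rewrite eq_sym mulf_eq0 orbb => /eqP.
  have b110 : b11 != 0.
    by apply: contraNneq d0 => z; rewrite /d b120 z; apply/eqP; ring.
  move: V1; rewrite b120; rsimp => V1.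
  suff -> : x = x' by [].
  apply: bool_eq => //; have := congr1 (fun z => z == 0) V1.
  by rewrite /= !mulf_eq0 (negbTE s0) (negbTE d0) (negbTE b110).
- move=> V1 V2 _ _ _ _; suff -> : x = x' by [].
  apply: bool_eq => //.
  have [x0|x0] := eqVneq x 0.
    move/eqP: V1; rewrite x0; rsimp.
    by rewrite !mulf_eq0 (negbTE s0) (negbTE d0) /= => ->.
  have b210 : b21 = 0.
    move/eqP: V2; rewrite eq_sym !mulf_eq0 (negbTE s0) (negbTE x0) /=.
    by rewrite orbF => /eqP.
  have b110 : b11 != 0.
    by apply: contraNneq d0 => z; rewrite /d b210 z; apply/eqP; ring.
  have := congr1 (fun z => z == 0) V1.
  by rewrite /= !mulf_eq0 (negbTE s0) (negbTE d0) (negbTE b110) (negbTE x0).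
Qed.


Lemma nfC_uniq a u1 u2 v1 m11 m12 v2 m21 m22 a' u1' u2' v1' m11' m12' v2' m21' m22' :
  nfC a u1 u2 v1 m11 m12 v2 m21 m22 ->
  nfC a' u1' u2' v1' m11' m12' v2' m21' m22' ->
  mxrel (mk a u1 u2 v1 m11 m12 v2 m21 m22)
        (mk a' u1' u2' v1' m11' m12' v2' m21' m22') ->
  mk a u1 u2 v1 m11 m12 v2 m21 m22 = mk a' u1' u2' v1' m11' m12' v2' m21' m22'.
Proof.
move=> N N' /mxrelE [s [b11 [b12 [b21 [b22 [k1 [k2 [c1 [c2 /=]]]]]]]]].
have [a0 [u10 u20] [m120 m220]] := nfC_entries N.
have [a0' [u10' u20'] [m120' m220']] := nfC_entries N'.
set d := _ - _; rewrite a0 u10 u20 a0' u10' u20' /bil.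
rsimp => -[[s0 d0] [c20 b120 db] [V1 V2] [E1 _] [E3 _]].
(* The equations for u1' and u2' give b12 = 0 and d = b22, hence d = b11 d. *)
have b11E : b11 = 1.
  by apply: (mulIf d0); rewrite mul1r {1}db /d -b120; ring.
move: V1 V2 E1 E3; rewrite -c20 -b120 b11E -db m120 m220; rsimp => V1 V2 E1 E3.
have sd0 : s * d != 0 by rewrite mulf_neq0.
have n1 : 1 <> 0 :> F by apply/eqP/oner_neq0.
clear a0 u10 u20 a0' u10' u20' m120 m220 m120' m220'.
destruct N as [t|x Hx| |t]; destruct N' as [t'|x' Hx'| |t'].
all: move: V1 V2 E1 E3; rsimp; move=> V1 V2 E1 E3; try by case: n1.
all: try by case/eqP: sd0.
all: try by case/eqP: d0.
all: try by case/eqP: s0.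
- have b210 : b21 = 0 by [].
  by move: V2; rewrite b210 -V1 E1; rsimp; rewrite mulrA E1 mul1r => ->.
- have s1 : s = 1 by apply: (mulIf d0); rewrite mul1r.
  move: V1; rewrite s1; rsimp => V1.
  suff -> : x = x' by [].
  case: Hx Hx' V1 => -> [] -> //; rsimp => z.
  + by case/eqP: d0.
  + by case: n1.
- by [].
- suff -> : t = t' by [].
  by apply: (mulfI sd0); rewrite V2 mulrA.
Qed.

(** The first row alone separates the families: whether u vanishes is invariant and, when it does,
    so is whether a vanishes. *)
Lemma normal_form_uniq a u1 u2 v1 m11 m12 v2 m21 m22
    a' u1' u2' v1' m11' m12' v2' m21' m22' :
  normal_form a u1 u2 v1 m11 m12 v2 m21 m22 ->
  normal_form a' u1' u2' v1' m11' m12' v2' m21' m22' ->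
  mxrel (mk a u1 u2 v1 m11 m12 v2 m21 m22)
        (mk a' u1' u2' v1' m11' m12' v2' m21' m22') ->
  mk a u1 u2 v1 m11 m12 v2 m21 m22 = mk a' u1' u2' v1' m11' m12' v2' m21' m22'.
Proof.
move=> N N' R; case: (N) => H; case: (N') => H'.
1: exact: nfA_uniq R.
4: exact: nfB_uniq R.
7: exact: nfC_uniq R.
all: exfalso; case/mxrelE: R => [s [b11 [b12 [b21 [b22 [k1 [k2 [c1 [c2 /=]]]]]]]]].
all: move=> [[s0 d0] [Ea Eu1 Eu2] _ _ _].
- have [a1 [u10 u20] _ _] := nfA_form2 H; have [a0' _ _ _] := nfB_form2 H'.
  by case/eqP: s0; move: Ea; rewrite a1 u10 u20 a0'; rsimp.
- have [a1 [u10 u20] _ _] := nfA_form2 H; have [_ [_ u21'] _] := nfC_entries H'.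
  by case/eqP: d0; move: Eu2; rewrite u10 u20 u21'; rsimp.
- have [a0 [u10 u20] _ _] := nfB_form2 H; have [a1' _ _ _] := nfA_form2 H'.
  by case/eqP: d0; move: Ea; rewrite a0 u10 u20 a1'; rsimp.
- have [_ [u10 u20] _ _] := nfB_form2 H; have [_ [_ u21'] _] := nfC_entries H'.
  by case/eqP: d0; move: Eu2; rewrite u10 u20 u21'; rsimp.
- have [_ [w10 w21] _] := nfC_entries H; have [_ [u10' u20'] _ _] := nfA_form2 H'.
  by case/eqP: d0; move: Eu1 Eu2; rewrite w10 w21 u10' u20'; rsimp; move=> <- <-; rsimp.
- have [_ [w10 w21] _] := nfC_entries H; have [_ [u10' u20'] _ _] := nfB_form2 H'.
  by case/eqP: d0; move: Eu1 Eu2; rewrite w10 w21 u10' u20'; rsimp; move=> <- <-; rsimp.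
Qed.
End Congruence.

(** * Squares in finite fields *)

Section Squares.
Local Open Scope ring_scope.
Variable F : finFieldType.

Lemma finField_generator : exists g : F, g != 0 /\ forall x, x != 0 -> exists i, x = g ^+ i.
Proof.
have /cyclicP[g gE] := field_unit_group_cyclic [set: {unit F}]%G.
exists (val g); split; first by rewrite -unitfE; apply: valP.
move=> x; rewrite -unitfE => Ux.
have /cycleP[i iE] : FinRing.unit F Ux \in <[g]>%g by rewrite -gE inE.
by exists i; rewrite -FinRing.val_unitX -iE.
Qed.

Variable eta : F.
Hypothesis eta_ns : forall s : F, s ^+ 2 != eta.

(** Nonzero elements are powers of one generator and eta is an odd power, so any other odd power
    differs from eta by a square. *)
Lemma eta_square_class (x : F) : x != 0 ->
  exists s nu, [/\ s != 0, nu = 1 \/ nu = eta & x = nu * s ^+ 2].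
Proof.
have [g [g0 gP]] := finField_generator.
have eta0 : eta != 0 by have := eta_ns 0; rewrite expr0n /= eq_sym.
have [i iE] := gP _ eta0; have oi : odd i.
  apply: contraNT (eta_ns (g ^+ i./2)) => ei.
  by rewrite iE -exprM muln2 -[in X in _ == X](odd_double_half i) (negbTE ei) add0n.
move=> /gP[j ->]; have [oj|ej] := boolP (odd j); last first.
  exists (g ^+ j./2), 1; split; [exact: expf_neq0 | by left |].
  by rewrite mul1r -exprM muln2 -[in LHS](odd_double_half j) (negbTE ej) add0n.
exists (g ^+ j./2 / g ^+ i./2), eta; split; [|by right|].
  by rewrite mulf_neq0 ?invr_eq0 ?expf_neq0.
rewrite iE -[in X in X * _](odd_double_half i) -[in LHS](odd_double_half j) oi oj.
have gi0 : g ^+ i./2 != 0 by rewrite expf_neq0.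
by rewrite !exprD -!muln2 !exprM expr1; field.
Qed.

Lemma diag_form_rep1 (x y : F) : x != 0 -> y != 0 ->
  exists s t, x * s ^+ 2 + y * t ^+ 2 = 1.
Proof.
move=> x0 y0; pose S := [set s ^+ 2 | s : F].
have eta0 : eta != 0 by have := eta_ns 0; rewrite expr0n /= eq_sym.
have S0 : 0 \in S by apply/imsetP; exists 0; rewrite ?inE // expr0n.
(* The sets S and eta S cover F and share 0, so more than half of F are squares. The sets x S and 1
   - y S therefore meet. *)
have cS : (#|F| < 2 * #|S|)%N.
  have cE : #|[set eta * z | z in S]| = #|S| by apply/card_imset/mulfI.
  have FE : [set: F] = S :|: [set eta * z | z in S].
    apply/setP=> z; rewrite !inE; apply/esym/orP; have [->|z0] := eqVneq z 0; first by left.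
    have [s [nu [s0 [->|->] ->]]] := eta_square_class z0.
      by left; rewrite mul1r; apply/imsetP; exists s.
    by right; apply/imsetP; exists (s ^+ 2) => //; apply/imsetP; exists s.
  rewrite -cardsT FE cardsU cE mul2n -addnn -subn_gt0 subKn; last first.
    by apply: leq_trans (subset_leq_card (subsetIl _ _)) _; apply: leq_addr.
  apply/card_gt0P; exists 0; rewrite inE S0 /=.
  by apply/imsetP; exists 0; rewrite ?mulr0.
pose A := [set x * z | z in S]; pose B := [set 1 - y * z | z in S].
have cA : #|A| = #|S| by apply/card_imset/mulfI.
have cB : #|B| = #|S| by apply: card_imset => u v /addrI/oppr_inj/(mulfI y0).
have : A :&: B != set0.
  apply: contraTneq cS => AB; rewrite -leqNgt mul2n -addnn -{1}cA -cB.
  by rewrite -cardsUI AB cards0 addn0 max_card.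
case/set0Pn=> z; rewrite inE.
case/andP=> /imsetP[_ /imsetP[s _ ->] ->] /imsetP[_ /imsetP[t _ ->] E].
by exists s, t; rewrite E subrK.
Qed.

End Squares.

Section Fp.
Local Open Scope ring_scope.
Variable p : nat.
Hypothesis p_prime : prime p.

Lemma natFp_eq0 n : (n%:R == 0 :> 'F_p) = (p %| n)%N.
Proof. by rewrite (dvdn_pcharf (pchar_Fp p_prime)). Qed.

Lemma Fp_nat (x : 'F_p) : exists2 n, (n < p)%N & x = n%:R.
Proof. by exists x; rewrite ?natr_Zp // -{2}(Fp_cast p_prime). Qed.

Lemma two_Fp_neq0 : odd p -> 2%:R != 0 :> 'F_p.
Proof.
move=> op; rewrite natFp_eq0 dvdn_prime2 //; apply: contraTneq op => ->; by [].
Qed.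

Lemma even_Fp : ~~ odd p -> 1 + 1 = 0 :> 'F_p /\ forall x : 'F_p, x = 0 \/ x = 1.
Proof.
move=> op; have p2 : p = 2%N by case: (even_prime p_prime) => // o; rewrite o in op.
split; first by apply/eqP; rewrite -[1 + 1]/(2%:R) natFp_eq0 p2.
move=> x; have [n + ->] := Fp_nat x; rewrite [X in (_ < X)%N]p2 => n2.
by case: n n2 => [|[|]] // _; [left | right].
Qed.
End Fp.

(** * The list of representatives *)


Section Listed.
Local Open Scope ring_scope.
Variables (p : nat) (eta : 'F_p).
Hypothesis p_prime : prime p.
Let is_nf := normal_form (odd p) eta.

Lemma e_mk i j : (0 < i <= 3)%N -> (0 < j <= 3)%N ->
  e p i j = mk ((i == 1) && (j == 1))%:R ((i == 1) && (j == 2))%:R ((i == 1) && (j == 3))%:R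
               ((i == 2) && (j == 1))%:R ((i == 2) && (j == 2))%:R ((i == 2) && (j == 3))%:R
               ((i == 3) && (j == 1))%:R ((i == 3) && (j == 2))%:R ((i == 3) && (j == 3))%:R.
Proof.
case: i j => [|[|[|[|i]]]] // [|[|[|[|j]]]] // _ _;
by apply/matrixP=> [[[|[|[|//]]] ?] [[|[|[|//]]] ?]]; rewrite !mxE -!val_eqE /= !inordK.
Qed.

Local Ltac mkE :=
  rewrite ?e_mk // ?mk_scale ?mk_opp ?mk_add ?mk_opp ?mk_add /=; rsimp.

Lemma D4_range (r : 'F_p) : odd p -> r != 0 -> r != -1 ->
  exists2 n, (1 <= n <= p - 2)%N & r = n%:R.
Proof.
move=> op; have [n np ->] := Fp_nat p_prime r => r0 r1; exists n => //.
have n0 : (0 < n)%N by case: n r0 {r1 np} => //; rewrite eqxx.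
rewrite n0 /= leq_subRL ?prime_gt1 // ltn_neqAle np andbT.
by apply: contraNneq r1 => nE; rewrite -subr_eq0 opprK natr1 nE pchar_Fp_0.
Qed.

Lemma normal_form_listed a u1 u2 v1 m11 m12 v2 m21 m22 :
  is_nf a u1 u2 v1 m11 m12 v2 m21 m22 ->
  listed eta (mk a u1 u2 v1 m11 m12 v2 m21 m22).
Proof.
have eq_listed w w' : listed eta w -> w = w' -> listed eta w' by move=> ? <-.
have n1 : 1 <> 0 :> 'F_p by apply/eqP/oner_neq0.
have p2 : ~~ odd p -> p = 2%N by case: (even_prime p_prime) => // ->.
case=> [[{}m11 {}m12 {}m21 {}m22]|[{}m11 {}m12 {}m21 {}m22|x|x|x]|[t|x||t]].
- case=> [o|nu o N|nu o N|r o r0 r1|o|o|o| |nu N| ].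
  + by apply: eq_listed (mx_D1 eta o) _; mkE.
  + by apply: eq_listed (mx_D2 o N) _; mkE.
  + by apply: eq_listed (mx_D3 o N) _; mkE.
  + have [n nP ->] := D4_range o r0 r1.
    by apply: eq_listed (mx_D4 eta o nP) _; mkE.
  + by apply: eq_listed (mx_D5 eta (p2 o)) _; mkE.
  + by apply: eq_listed (mx_D6 eta (p2 o)) _; mkE.
  + by apply: eq_listed (mx_D7 eta (p2 o)) _; mkE.
  + by apply: eq_listed (mx_E8 eta) _; mkE.
  + by apply: eq_listed (mx_E9 N) _; mkE.
  + by apply: eq_listed (mx_F1 eta) _; mkE.
- case=> [o|nu o N|nu o N|r o r0 r1|o|o|o| |nu N| ]; rsimp => D0 [] z.
  1,2: by apply: eq_listed (mx_E1 eta o) _; mkE.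
  (* Here m11 is nu, which [z] makes 0 or 1. Nothing excludes nu = 0 at this point, but it also
     gives a listed matrix, E1. *)
  + by rewrite z; apply: eq_listed (mx_E1 eta o) _; mkE.
  + by rewrite z; apply: eq_listed (mx_E2 eta o) _; mkE.
  1,2: by apply: eq_listed (mx_E3 o N) _; mkE.
  1,2: by have [n nP ->] := D4_range o r0 r1; apply: eq_listed (mx_E4 eta o nP) _; mkE.
  1,2: by apply: eq_listed (mx_E5 eta (p2 o)) _; mkE.
  1,2: by apply: eq_listed (mx_E6 eta (p2 o)) _; mkE.
  1,2: by apply: eq_listed (mx_E7 eta (p2 o)) _; mkE.
  1-6: by case/eqP: D0.
- case=> ->.
  + by apply: eq_listed (mx_F2 eta) _; mkE.
  + by apply: eq_listed (mx_E10 eta) _; mkE.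
- case=> ->.
  + by apply: eq_listed (mx_F3 eta) _; mkE.
  + by apply: eq_listed (mx_E11 eta) _; mkE.
- case=> ->.
  + by rewrite -mk0; exact: mx_F5.
  + by apply: eq_listed (mx_F4 eta) _; mkE.
- have [->|t0] := eqVneq t 0.
  + by apply: eq_listed (mx_E12 eta) _; mkE.
  + by apply: eq_listed (mx_D8 eta t0) _; mkE.
- case=> ->.
  + by apply: eq_listed (mx_E13 eta) _; mkE.
  + by apply: eq_listed (mx_D9 eta) _; mkE.
- by apply: eq_listed (mx_E14 eta) _; mkE.
- have [->|t0] := eqVneq t 0.
  + by apply: eq_listed (mx_F6 eta) _; mkE.
  + by apply: eq_listed (mx_E15 eta t0) _; mkE.
Qed.

Hypothesis eta_ns : odd p -> forall s : 'F_p, s ^+ 2 != eta.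

Lemma listed_normal_form w : listed eta w ->
  exists a u1 u2 v1 m11 m12 v2 m21 m22,
    w = mk a u1 u2 v1 m11 m12 v2 m21 m22 /\ is_nf a u1 u2 v1 m11 m12 v2 m21 m22.
Proof.
have n1 : 1 != 0 :> 'F_p := oner_neq0 _.
have ev : p = 2%N -> ~~ odd p by move=> ->.
have nf0 nu (o : odd p) (N : nu_range eta nu) : nu != 0 := nu_ok_neq0 (fun=> eta_ns o) N.
have r0 (o : odd p) n : (1 <= n <= p - 2)%N -> n%:R != 0 :> 'F_p /\ n%:R != -1 :> 'F_p.
  move=> /andP[n0 np]; rewrite -addr_eq0 natr1 !natFp_eq0 //.
  have np1 : (n.+1 < p)%N.
    by rewrite -(subnK (prime_gt1 p_prime)) addn2 !ltnS.
  by split; rewrite gtnNdvd //; apply: ltnW.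
case=> [o|nu o N|nu o N|r o rP|o|o|nu o N|r o rP|/ev o|/ev o|/ev o|/ev o|/ev o|/ev o
  |t t0|||nu N||||||t t0||||||].
- exists 1, 0, 0, 0, 0, 1, 0, (-1), 0; split; first by mkE.
  by constructor 1; constructor; exact: Alt.
- exists 1, 0, 0, 0, nu, 1, 0, (-1), 0; split; first by mkE.
  by constructor 1; constructor; exact: AltRank1.
- exists 1, 0, 0, 0, 1, 0, 0, 0, nu; split; first by mkE.
  by constructor 1; constructor; exact: SymDiag.
- exists 1, 0, 0, 0, 1, 1, 0, (-1), r%:R; split; first by mkE.
  by constructor 1; constructor; have [] := r0 o _ rP; apply: AltDiag.
- exists 0, 0, 0, 0, 0, 1, 0, (-1), 0; split; first by mkE.
  by constructor 2; constructor; [exact: Alt | rsimp | left].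
- exists 0, 0, 0, 0, 1, 1, 0, (-1), 0; split; first by mkE.
  by constructor 2; constructor; [apply: AltRank1; [|left] | rsimp | right].
- exists 0, 0, 0, 0, 1, 0, 0, 0, nu; split; first by mkE.
  by constructor 2; constructor; [exact: SymDiag | rsimp; exact: nf0 | right].
- exists 0, 0, 0, 0, 1, 1, 0, (-1), r%:R; split; first by mkE.
  have [r1 r2] := r0 o _ rP; constructor 2; constructor; [exact: AltDiag | rsimp | by right].
  by rewrite addr_eq0.
- exists 1, 0, 0, 0, 0, 1, 0, 1, 0; split; first by mkE.
  by constructor 1; constructor; exact: Alt2.
- exists 1, 0, 0, 0, 1, 0, 0, 0, 1; split; first by mkE.
  by constructor 1; constructor; exact: Diag2.
- exists 1, 0, 0, 0, 1, 0, 0, 1, 1; split; first by mkE.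
  by constructor 1; constructor; exact: Asym2.
- exists 0, 0, 0, 0, 0, 1, 0, 1, 0; split; first by mkE.
  by constructor 2; constructor; [exact: Alt2 | rsimp; rewrite oppr_eq0 | left].
- exists 0, 0, 0, 0, 1, 0, 0, 0, 1; split; first by mkE.
  by constructor 2; constructor; [exact: Diag2 | rsimp | right].
- exists 0, 0, 0, 0, 1, 0, 0, 1, 1; split; first by mkE.
  by constructor 2; constructor; [exact: Asym2 | rsimp | right].
- by exists 0, 0, 1, 0, 1, 0, t, 0, 0; split; [mkE | constructor 3; constructor].
- by exists 0, 0, 1, 1, 0, 0, 0, 1, 0; split; [mkE | constructor 3; constructor; right].
- exists 1, 0, 0, 0, 0, 1, 0, 0, 0; split; first by mkE.
  by constructor 1; constructor; exact: Nilp.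
- exists 1, 0, 0, 0, 0, 0, 0, 0, nu; split; first by mkE.
  by constructor 1; constructor; exact: SymRank1.
- by exists 0, 0, 0, 0, 0, 1, 1, 0, 0; split; [mkE | constructor 2; constructor; right].
- by exists 0, 0, 0, 1, 0, 0, 0, 0, 1; split; [mkE | constructor 2; constructor; right].
- by exists 0, 0, 1, 0, 1, 0, 0, 0, 0; split; [mkE | constructor 3; constructor].
- by exists 0, 0, 1, 0, 0, 0, 0, 1, 0; split; [mkE | constructor 3; constructor; left].
- by exists 0, 0, 1, 1, 0, 0, 0, 0, 0; split; [mkE | constructor 3; constructor].
- by exists 0, 0, 1, 0, 0, 0, t, 0, 0; split; [mkE | constructor 3; constructor].
- exists 1, 0, 0, 0, 0, 0, 0, 0, 0; split; first by mkE.
  by constructor 1; constructor; exact: Zero2.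
- by exists 0, 0, 0, 0, 0, 1, 0, 0, 0; split; [mkE | constructor 2; constructor; left].
- by exists 0, 0, 0, 0, 0, 0, 0, 0, 1; split; [mkE | constructor 2; constructor; left].
- by exists 0, 0, 0, 1, 0, 0, 0, 0, 0; split; [mkE | constructor 2; constructor; right].
- by exists 0, 0, 0, 0, 0, 0, 0, 0, 0; split; [rewrite -mk0 | constructor 2; constructor; left].
- by exists 0, 0, 1, 0, 0, 0, 0, 0, 0; split; [mkE | constructor 3; constructor].
Qed.

Lemma sq_class_Fp (x : 'F_p) : x != 0 ->
  exists s nu, [/\ s != 0, nu_ok (odd p) eta nu & x = nu * s ^+ 2].
Proof.
move=> x0; have [o|o] := boolP (odd p).
  have [s [nu [s0 N ->]]] := eta_square_class (eta_ns o) x0; exists s, nu; split=> //.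
  by case: N; [left | right].
exists 1, 1; split; [exact: oner_neq0 | by left |].
by rewrite expr1n mulr1; case: (even_Fp p_prime o) => _ /(_ x) [xE|//]; rewrite xE eqxx in x0.
Qed.

Lemma listed_exists (w : 'M['F_p]_3) : exists w', listed eta w' /\ mxrel w w'.
Proof.
have rep1 (o : odd p) (x y : 'F_p) : x != 0 -> y != 0 ->
    exists s t, x * s ^+ 2 + y * t ^+ 2 = 1.
  exact: (@diag_form_rep1 'F_p eta (eta_ns o)).

have [a [u1 [u2 [v1 [m11 [m12 [v2 [m21 [m22 [N R]]]]]]]]]] :=
  reducible_all (two_Fp_neq0 p_prime) (even_Fp p_prime) eta_ns sq_class_Fp rep1
   (w (idx 1) (idx 1)) (w (idx 1) (idx 2)) (w (idx 1) (idx 3))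
   (w (idx 2) (idx 1)) (w (idx 2) (idx 2)) (w (idx 2) (idx 3))
   (w (idx 3) (idx 1)) (w (idx 3) (idx 2)) (w (idx 3) (idx 3)).
exists (mk a u1 u2 v1 m11 m12 v2 m21 m22); split; first exact: normal_form_listed.
by rewrite [w]mk_eta.
Qed.

Lemma listed_uniq (w w' : 'M['F_p]_3) :
  listed eta w -> listed eta w' -> mxrel w w' -> w = w'.
Proof.
move=> /listed_normal_form[a [u1 [u2 [v1 [m11 [m12 [v2 [m21 [m22 [-> N]]]]]]]]]].
move=> /listed_normal_form[a' [u1' [u2' [v1' [m11' [m12' [v2' [m21' [m22' [-> N']]]]]]]]]].
exact: (normal_form_uniq (two_Fp_neq0 p_prime) (even_Fp p_prime) eta_ns).
Qed.

End Listed.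

(** * Linear combinations in elementary abelian groups *)

Section Phi.
Local Open Scope group_scope.
Variables (p : nat) (gT : finGroupType).
Hypothesis p_prime : prime p.

(** An F_p-linear combination in multiplicative notation. Exponents are read as representatives, so
    it is additive in the coefficients once x, y, z lie in an elementary abelian p-group. *)
Definition phi (x y z : gT) (r1 r2 r3 : 'F_p) : gT := x ^+ r1 * y ^+ r2 * z ^+ r3.

Section Abelem.
Variables (E : {group gT}) (x y z : gT).
Implicit Types u v : gT.
Hypothesis abelE : p.-abelem E.

Lemma abelem_expF u n : u \in E -> u ^+ (n%:R : 'F_p)%R = u ^+ n.
Proof.
move=> Eu; have up : u ^+ p = 1 by case/abelemP: abelE => // _; apply.
by rewrite val_Fp_nat // -(expg_mod n up).
Qed.

Lemma abelem_expFD u (r s : 'F_p) : u \in E -> u ^+ (r + s)%R = u ^+ r * u ^+ s.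
Proof.
move=> Eu; have [i _ ->] := Fp_nat p_prime r; have [j _ ->] := Fp_nat p_prime s.
by rewrite -natrD !abelem_expF ?expgD.
Qed.

Hypotheses (Ex : x \in E) (Ey : y \in E) (Ez : z \in E).

Let cE u v : u \in E -> v \in E -> commute u v.
Proof. by move=> Eu Ev; apply: (centsP (abelem_abelian abelE)) Eu _ Ev. Qed.

Lemma phi_mem r1 r2 r3 : phi x y z r1 r2 r3 \in E.
Proof. by rewrite !groupM ?groupX. Qed.

Lemma phiD r1 r2 r3 s1 s2 s3 :
  phi x y z (r1 + s1)%R (r2 + s2)%R (r3 + s3)%R = phi x y z r1 r2 r3 * phi x y z s1 s2 s3.
Proof.
rewrite /phi !abelem_expFD //.
have c (u v : gT) (r s : 'F_p) : u \in E -> v \in E -> commute (u ^+ r) (v ^+ s).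
  by move=> Eu Ev; apply: cE; rewrite groupX.
rewrite -!mulgA; congr (_ * _).
rewrite (mulgA (z ^+ r3) (x ^+ s1)) (c z x) // -mulgA.
rewrite (mulgA (y ^+ r2) (x ^+ s1)) (c y x) // -mulgA.
by rewrite (mulgA (z ^+ r3) (y ^+ s2)) (c z y) // -mulgA.
Qed.

Lemma phiZ r1 r2 r3 s :
  phi x y z (s * r1)%R (s * r2)%R (s * r3)%R = phi x y z r1 r2 r3 ^+ s.
Proof.
have [n _ ->] := Fp_nat p_prime s; rewrite abelem_expF ?phi_mem //.
elim: n => [|n IHn]; first by rewrite !mul0r /phi !expg0 !mulg1.
by rewrite -natr1 !mulrDl !mul1r phiD IHn expgSr.
Qed.

Lemma phi_nat n1 n2 n3 :
  phi x y z n1%:R%R n2%:R%R n3%:R%R = x ^+ n1 * y ^+ n2 * z ^+ n3.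
Proof. by rewrite /phi !abelem_expF. Qed.

Lemma phi_comp a1 a2 a3 b1 b2 b3 c1 c2 c3 r1 r2 r3 :
  phi (phi x y z a1 a2 a3) (phi x y z b1 b2 b3) (phi x y z c1 c2 c3) r1 r2 r3 =
  phi x y z (r1 * a1 + r2 * b1 + r3 * c1)%R (r1 * a2 + r2 * b2 + r3 * c2)%R
            (r1 * a3 + r2 * b3 + r3 * c3)%R.
Proof. by rewrite !phiD !phiZ. Qed.

Lemma phi_surj : <<[set x; y; z]>> = E ->
  forall u, u \in E -> exists r1 r2 r3, u = phi x y z r1 r2 r3.
Proof.
move=> EE u; rewrite -EE => /gen_prodgP[n [c cP ->]].
elim/big_rec: _ => [|i v _ [r1 [r2 [r3 ->]]]].
  by exists 0%R, 0%R, 0%R; rewrite /phi !expg0 !mulg1.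
have [s1 [s2 [s3 ->]]] : exists s1 s2 s3, c i = phi x y z s1 s2 s3.
  have := cP i; rewrite !inE -orbA => /or3P[] /eqP->.
  - by exists 1%R, 0%R, 0%R; rewrite (phi_nat 1 0 0) !expg0 !mulg1.
  - by exists 0%R, 1%R, 0%R; rewrite (phi_nat 0 1 0) !expg0 mulg1 mul1g.
  - by exists 0%R, 0%R, 1%R; rewrite (phi_nat 0 0 1) !expg0 !mul1g.
by exists (s1 + r1)%R, (s2 + r2)%R, (s3 + r3)%R; rewrite phiD.
Qed.

(** The p^3 triples of coefficients map onto a group of order p^3. *)
Lemma phi_inj : <<[set x; y; z]>> = E -> #|E| = (p ^ 3)%N ->
  forall r1 r2 r3 s1 s2 s3, phi x y z r1 r2 r3 = phi x y z s1 s2 s3 ->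
  [/\ r1 = s1, r2 = s2 & r3 = s3].
Proof.
move=> EE cE3 r1 r2 r3 s1 s2 s3.
pose f (t : 'F_p * 'F_p * 'F_p) := phi x y z t.1.1 t.1.2 t.2.
have fE : f @: [set: 'F_p * 'F_p * 'F_p] = E :> {set gT}.
  apply/setP=> u; apply/imsetP/idP => [[t _ ->]|Eu]; first exact: phi_mem.
  by have [t1 [t2 [t3 ->]]] := phi_surj EE Eu; exists (t1, t2, t3).
have /imset_injP finj : #|f @: [set: 'F_p * 'F_p * 'F_p]| == #|[set: 'F_p * 'F_p * 'F_p]|.
  by rewrite fE cE3 cardsT !card_prod card_Fp // expnS expnS mulnA.
by move=> /(finj (r1, r2, r3) (s1, s2, s3) (in_setT _) (in_setT _))[-> -> ->].
Qed.

End Abelem.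
End Phi.

(** * Three-generator groups of class two *)

Section ThreeGenerators.
Local Open Scope group_scope.
Variables (gT : finGroupType) (G : {group gT}) (a1 a2 a3 : gT).
Implicit Types g h : gT.
Let bar := coset G^`(1).
Hypotheses (Ga1 : a1 \in G) (Ga2 : a2 \in G) (Ga3 : a3 \in G).

Lemma der1_norm g : g \in G -> g \in 'N(G^`(1)).
Proof. by apply: subsetP; apply: der_norm. Qed.

Lemma abelianization_gen : <<[set a1; a2; a3]>> = G ->
  <[bar a1]> \* <[bar a2]> \* <[bar a3]> = G / G^`(1).
Proof.
move=> genG; have abA : abelian (G / G^`(1)) := der_abelian 0 G.
have Ab g : g \in G -> <[bar g]> \subset G / G^`(1).
  by move=> Gg; rewrite cycle_subG mem_quotient.
have c i j : i \in G -> j \in G -> <[bar j]> \subset 'C(<[bar i]>).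
  move=> Gi Gj; apply: subset_trans (Ab _ Gj) _.
  by apply: subset_trans abA _; apply: centS; apply: Ab.
have cE12 : <[bar a1]> \* <[bar a2]> = <[bar a1]> <*> <[bar a2]> by rewrite cprodEY ?c.
rewrite cE12 cprodEY ?centY ?subsetI ?c //.
apply/eqP; rewrite eqEsubset !join_subG !Ab //=.
rewrite -(congr1 (fun K : {set gT} => K / G^`(1)) genG) quotient_gen; last first.
  by rewrite !subUset !sub1set !der1_norm.
rewrite gen_subG; apply/subsetP=> _ /morphimP[g _ + ->].
rewrite !inE -orbA => /or3P[] /eqP->.
- by do 2!apply: (subsetP (joing_subl _ _)); exact: cycle_id.
- by apply: (subsetP (joing_subl _ _)); apply: (subsetP (joing_subr _ _)); exact: cycle_id.
- by apply: (subsetP (joing_subr _ _)); exact: cycle_id.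
Qed.

(** The three cyclic factors have orders at most n1, n2, n3 and generate a group of order n1 n2 n3,
    which leaves no room for intersections or smaller orders. *)
Lemma abelianization_dprod n1 n2 n3 : <<[set a1; a2; a3]>> = G ->
  #|G / G^`(1)| = (n1 * n2 * n3)%N -> 
  0 < n1 -> 0 < n2 -> 0 < n3 ->
  a1 ^+ n1 \in G^`(1) -> a2 ^+ n2 \in G^`(1) -> a3 ^+ n3 \in G^`(1) ->
  <[bar a1]> \x <[bar a2]> \x <[bar a3]> = G / G^`(1) /\
  [/\ #[bar a1] = n1, #[bar a2] = n2 & #[bar a3] = n3].
Proof.
move=> genG cA n1_0 n2_0 n3_0 e1 e2 e3.
have ole (g : gT) n : 0 < n -> g \in G -> g ^+ n \in G^`(1) -> #[bar g] <= n.
  move=> n0 Gg gn; apply: dvdn_leq => //; rewrite order_dvdn -morphX ?der1_norm //.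
  by apply/eqP; apply: coset_id.
have := abelianization_gen genG; rewrite -cprodA => cE.
have l1 := ole _ _ n1_0 Ga1 e1; have l2 := ole _ _ n2_0 Ga2 e2; have l3 := ole _ _ n3_0 Ga3 e3.
have dE : \big[dprod/1]_(b <- [:: bar a1; bar a2; bar a3]) <[b]> = G / G^`(1).
  apply: bigcprod_card_dprod; first by rewrite !big_cons big_nil cprodg1.
  rewrite !big_cons big_nil muln1 cA -mulnA.
  by rewrite !leq_mul.
have := bigdprod_card dE; rewrite !big_cons big_nil muln1 cA.
move: dE; rewrite !big_cons big_nil dprodg1 dprodA => dE oE; split=> //.
move: (order_gt0 (bar a1)) (order_gt0 (bar a2)) (order_gt0 (bar a3)) oE l1 l2 l3.
rewrite /order.
move: #|_| #|_| #|_| => o1 o2 o3 p1 p2 p3 oE l1 l2 l3.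
case: (leqif_mul (leqif_eq l1) (leqif_mul (leqif_eq l2) (leqif_eq l3))) => _.
rewrite oE -mulnA eqxx !muln_eq0 !(gtn_eqF n1_0, gtn_eqF n2_0, gtn_eqF n3_0) /=.
by case/esym/and3P=> /eqP -> /eqP -> /eqP ->.
Qed.

Lemma abelianization_elt g :
  <[bar a1]> \* <[bar a2]> \* <[bar a3]> = G / G^`(1) -> g \in G ->
  exists i j k (h : gT), h \in G^`(1) /\ g = a1 ^+ i * a2 ^+ j * a3 ^+ k * h.
Proof.
move=> defA Gg; have : bar g \in G / G^`(1) by rewrite mem_quotient.
case/cprodP: (defA) => [[K L defK _] _ _].
rewrite -(cprodW defA) defK -(cprodW defK).
case/mulsgP=> _ _ /mulsgP[_ _ /cycleP[i ->] /cycleP[j ->] ->] /cycleP[k ->] gE.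
exists i, j, k, ((a1 ^+ i * a2 ^+ j * a3 ^+ k)^-1 * g); rewrite mulKVg; split=> //.
have GE : a1 ^+ i * a2 ^+ j * a3 ^+ k \in G by rewrite !groupM ?groupX.
apply: coset_idr; first by rewrite der1_norm // groupM ?groupV.
rewrite morphM ?morphV ?der1_norm ?groupV //= [coset _ g]gE /bar.
by rewrite !morphM ?morphX ?der1_norm ?groupM ?groupX // mulVg.
Qed.

(** Generation modulo G' lifts to G because the elements of the Frattini subgroup are
    nongenerators. *)
Lemma abelianization_dprod_gen : G^`(1) \subset 'Phi(G) ->
  <[bar a1]> \x <[bar a2]> \x <[bar a3]> = G / G^`(1) -> <<[set a1; a2; a3]>> = G.
Proof.
move=> sG'Phi defA; apply: Phi_nongen; apply/eqP; rewrite eqEsubset; apply/andP; split.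
  by rewrite join_subG Phi_sub !subUset !sub1set Ga1 Ga2 Ga3.
apply/subsetP=> g Gg.
have sS (a : gT) : a \in [set a1; a2; a3] -> a \in 'Phi(G) <*> [set a1; a2; a3].
  by move=> Sa; rewrite mem_gen // inE Sa orbT.
have sG' : G^`(1) \subset 'Phi(G) <*> [set a1; a2; a3].
  exact: subset_trans sG'Phi (joing_subl _ _).
have [|i [j [k [h [G'h ->]]]]] := abelianization_elt _ Gg.
  case/dprodP: (defA) => [[K L defK _] _ _ _].
  by rewrite -(dprodWcp defA) defK (dprodWcp defK).
have [S1 S2 S3] : [/\ a1 \in 'Phi(G) <*> [set a1; a2; a3],
    a2 \in 'Phi(G) <*> [set a1; a2; a3] & a3 \in 'Phi(G) <*> [set a1; a2; a3]].
  by split; apply: sS; rewrite !inE eqxx ?orbT.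
by rewrite !groupM ?groupX // (subsetP sG').
Qed.

End ThreeGenerators.

(** * Commutator and power calculus in class two *)

Section ClassTwo.
Local Open Scope group_scope.
Variables (p : nat) (gT : finGroupType) (G : {group gT}).
Hypothesis p_prime : prime p.
Implicit Types u v w g h : gT.
Hypothesis abelG' : p.-abelem G^`(1).
Hypothesis cenG' : G^`(1) \subset 'Z(G).

Lemma der1_comm u v : u \in G -> v \in G -> [~ u, v] \in G^`(1).
Proof. exact: mem_commg. Qed.

Lemma der1_central h u : h \in G^`(1) -> u \in G -> commute h u.
Proof. by move=> /(subsetP cenG')/centerP[_ ch] Gu; apply: ch. Qed.

Lemma der1_exp h n : h \in G^`(1) -> p %| n -> h ^+ n = 1.
Proof.
move=> G'h /dvdnP[k ->]; rewrite mulnC expgM.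
by case/abelemP: abelG' => // _ ->; rewrite ?expg1n.
Qed.

Lemma commMl u v w : u \in G -> v \in G -> w \in G ->
  [~ u * v, w] = [~ u, w] * [~ v, w].
Proof.
move=> Gu Gv Gw; rewrite commMgJ; congr (_ * _); apply/conjg_fixP/commgP.
exact: der1_central (der1_comm Gu Gw) Gv.
Qed.

Lemma commMr u v w : u \in G -> v \in G -> w \in G ->
  [~ w, u * v] = [~ w, u] * [~ w, v].
Proof.
move=> Gu Gv Gw; rewrite commgMJ (_ : [~ w, u] ^ v = [~ w, u]).
  exact: der1_central (der1_comm Gw Gv) (groupR Gw Gu).
by apply/conjg_fixP/commgP; apply: der1_central (der1_comm Gw Gu) Gv.
Qed.

Lemma commXl u v n : u \in G -> v \in G -> [~ u ^+ n, v] = [~ u, v] ^+ n.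
Proof.
move=> Gu Gv; elim: n => [|n IHn]; first by rewrite comm1g.
by rewrite !expgS commMl ?groupX // IHn.
Qed.

Lemma commXr u v n : u \in G -> v \in G -> [~ v, u ^+ n] = [~ v, u] ^+ n.
Proof.
move=> Gu Gv; elim: n => [|n IHn]; first by rewrite commg1.
by rewrite !expgS commMr ?groupX // IHn.
Qed.

(** In class two the correction term is [v, u]^C(n, 2), which is trivial because G' has exponent
    p. *)
Lemma expMg_class2 u v n : u \in G -> v \in G -> p %| 'C(n, 2) ->
  (u * v) ^+ n = u ^+ n * v ^+ n.
Proof.
move=> Gu Gv pC; have G'c := der1_comm Gv Gu.
by rewrite expMg_Rmul ?(der1_exp _ pC) ?mulg1 //;
   apply/commute_sym/der1_central.
Qed.

Section Combination.
Variables (a1 a2 a3 : gT).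
Hypotheses (Ga1 : a1 \in G) (Ga2 : a2 \in G) (Ga3 : a3 \in G).
Let x := [~ a2, a3].
Let y := [~ a3, a1].
Let z := [~ a1, a2].
Let ph := @phi p gT x y z.

Let G'x : x \in G^`(1). Proof. exact: der1_comm. Qed.
Let G'y : y \in G^`(1). Proof. exact: der1_comm. Qed.
Let G'z : z \in G^`(1). Proof. exact: der1_comm. Qed.

Let phiE := (abelem_expF p_prime abelG', phi_nat p_prime abelG' G'x G'y G'z).

Definition comb i j k h : gT := a1 ^+ i * a2 ^+ j * a3 ^+ k * h.

Lemma comb_mem i j k h : h \in G^`(1) -> comb i j k h \in G.
Proof. by move=> G'h; rewrite !groupM ?groupX // (subsetP (der_sub 1 G)). Qed.

Local Open Scope ring_scope.
Let cm (u v : gT) r1 r2 r3 := [~ u, v]%g = ph r1 r2 r3.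

(** Commutation is bilinear and alternating modulo G'. With x, y, z in cyclic order its coordinates
    are the cross product of the exponent vectors. *)
Lemma comm_comb i1 i2 i3 g j1 j2 j3 h : g \in G^`(1)%g -> h \in G^`(1)%g ->
  [~ comb i1 i2 i3 g, comb j1 j2 j3 h]%g =
  ph (i2%:R * j3%:R - i3%:R * j2%:R) (i3%:R * j1%:R - i1%:R * j3%:R)
     (i1%:R * j2%:R - i2%:R * j1%:R).
Proof.
move=> G'g G'h; have Gg := subsetP (der_sub 1 G) _ G'g; have Gh := subsetP (der_sub 1 G) _ G'h.
have phi0 : ph 0 0 0 = 1%g by rewrite /ph /phi !expg0 !mulg1.
have phiV r1 r2 r3 : ((ph r1 r2 r3)^-1)%g = ph (- r1) (- r2) (- r3).
  apply/esym/eqP; rewrite eq_sym eq_invg_mul /ph -(phiD p_prime abelG') //.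
  by rewrite !subrr; apply/eqP.
have cml (u u' v : gT) r1 r2 r3 s1 s2 s3 : u \in G -> u' \in G -> v \in G ->
    cm u v r1 r2 r3 -> cm u' v s1 s2 s3 -> cm (u * u')%g v (r1 + s1) (r2 + s2) (r3 + s3).
  by move=> Gu Gu' Gv E E'; rewrite /cm commMl // E E' /ph (phiD p_prime abelG').
have cmr (u u' v : gT) r1 r2 r3 s1 s2 s3 : u \in G -> u' \in G -> v \in G ->
    cm v u r1 r2 r3 -> cm v u' s1 s2 s3 -> cm v (u * u')%g (r1 + s1) (r2 + s2) (r3 + s3).
  by move=> Gu Gu' Gv E E'; rewrite /cm commMr // E E' /ph (phiD p_prime abelG').
have cmX (u v : gT) i j r1 r2 r3 : u \in G -> v \in G ->
    cm u v r1 r2 r3 ->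
    cm (u ^+ i)%g (v ^+ j)%g (i%:R * j%:R * r1) (i%:R * j%:R * r2) (i%:R * j%:R * r3).
  move=> Gu Gv E; rewrite /cm commXl ?commXr ?groupX // E -expgM mulnC.
  by rewrite /ph -natrM (phiZ p_prime abelG') // phiE // phi_mem.
have cmV (u v : gT) r1 r2 r3 : cm u v r1 r2 r3 -> cm v u (- r1) (- r2) (- r3).
  by rewrite /cm => E; rewrite -phiV -E invg_comm.
have c23 : cm a2 a3 1 0 0.
  by rewrite /cm /ph (phi_nat p_prime abelG' G'x G'y G'z 1 0 0) !expg0 !mulg1.
have c31 : cm a3 a1 0 1 0.
  by rewrite /cm /ph (phi_nat p_prime abelG' G'x G'y G'z 0 1 0) !expg0 mulg1 mul1g.
have c12 : cm a1 a2 0 0 1.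
  by rewrite /cm /ph (phi_nat p_prime abelG' G'x G'y G'z 0 0 1) !expg0 !mul1g.
have cc (u : gT) : cm u u 0 0 0 by rewrite /cm phi0; apply/eqP/commgP; exact: commute_refl.
have cl (u v : gT) : u \in G^`(1)%g -> v \in G -> cm u v 0 0 0.
  by move=> G'u Gv; rewrite /cm phi0; apply/eqP/commgP; apply: der1_central.
have cr (u v : gT) : u \in G^`(1)%g -> v \in G -> cm v u 0 0 0.
  by move=> G'u Gv; rewrite /cm phi0; apply/eqP/commgP/commute_sym; apply: der1_central.
have row (u : gT) i r1 r2 r3 s1 s2 s3 t1 t2 t3 : u \in G ->
    cm u a1 r1 r2 r3 -> cm u a2 s1 s2 s3 -> cm u a3 t1 t2 t3 ->
    cm (u ^+ i)%g (comb j1 j2 j3 h)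
     (i%:R * j1%:R * r1 + i%:R * j2%:R * s1 + i%:R * j3%:R * t1 + 0)
     (i%:R * j1%:R * r2 + i%:R * j2%:R * s2 + i%:R * j3%:R * t2 + 0)
     (i%:R * j1%:R * r3 + i%:R * j2%:R * s3 + i%:R * j3%:R * t3 + 0).
  move=> Gu E1 E2 E3; rewrite /comb.
  apply: (cmr); rewrite ?groupM ?groupX //; last by apply: cr; rewrite ?groupX.
  apply: (cmr); rewrite ?groupM ?groupX //; last exact: cmX.
  by apply: (cmr); rewrite ?groupX //; exact: cmX.
have Gc : comb j1 j2 j3 h \in G by apply: comb_mem.
have := cml _ _ _ _ _ _ _ _ _ (groupM (groupM (groupX i1 Ga1) (groupX i2 Ga2)) (groupX i3 Ga3))
  Gg Gc
  (cml _ _ _ _ _ _ _ _ _ (groupM (groupX i1 Ga1) (groupX i2 Ga2)) (groupX i3 Ga3) Gc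
  (cml _ _ _ _ _ _ _ _ _ (groupX i1 Ga1) (groupX i2 Ga2) Gc
    (row _ i1 _ _ _ _ _ _ _ _ _ Ga1 (cc a1) c12 (cmV _ _ _ _ _ c31))
    (row _ i2 _ _ _ _ _ _ _ _ _ Ga2 (cmV _ _ _ _ _ c12) (cc a2) c23))
    (row _ i3 _ _ _ _ _ _ _ _ _ Ga3 c31 (cmV _ _ _ _ _ c23) (cc a3)))
  (cl _ _ G'g Gc).
rewrite /cm => ->; congr ph; ring.
Qed.
End Combination.
End ClassTwo.

(** * Characteristic generators *)

(** The exception p = 2, m = 1 is real, since C(2, 2) = 1; here the assumption m2 > 1 enters. *)
Lemma dvdn_bin2_prime_power p m : prime p -> 0 < m -> (p = 2 -> 1 < m) -> p %| 'C(p ^ m, 2).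
Proof.
move=> pp m0 m2; case: (even_prime pp) => [p2|op].
  rewrite p2 in m2 *; case: m {m0} m2 => [|[|m]] m2; try by have := m2 erefl.
  rewrite bin2 !expnS -mulnA mul2n doubleK -mulnA; exact: dvdn_mulr.
rewrite -(@Gauss_dvdr _ 2); last by rewrite coprimen2.
rewrite (_ : 2 * 'C(p ^ m, 2) = p ^ m * (p ^ m).-1)%N; last by rewrite -mul_bin_diag bin1.
by rewrite dvdn_mulr // dvdn_exp.
Qed.

Section Standing.
Local Open Scope group_scope.
Variables (p m1 m : nat) (gT : finGroupType) (G : {group gT}).
Hypotheses (p_prime : prime p) (m_gt0 : 0 < m) (m_lt_m1 : m < m1)
  (m_gt1 : p = 2 -> 1 < m) (stG : standing p m1 m m G).

Definition phi_row (x y z : gT) (w : 'M['F_p]_3) (i : nat) : gT :=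
  phi x y z (w (idx i) (idx 1)) (w (idx i) (idx 2)) (w (idx i) (idx 3)).

(** For a group as in [standing] this is equivalent to [characteristic_generators]: generation
    replaces the direct decomposition of G / G', so new generators and isomorphic images are easier
    to check. *)
Definition gen_rows (w : 'M['F_p]_3) (a1 a2 a3 : gT) : Prop :=
  let row := phi_row [~ a2, a3] [~ a3, a1] [~ a1, a2] w in
  [/\ [/\ a1 \in G, a2 \in G & a3 \in G], <<[set a1; a2; a3]>> = G
    & [/\ a1 ^+ (p ^ m1) = row 1%N, a2 ^+ (p ^ m) = row 2%N & a3 ^+ (p ^ m) = row 3%N]].

Lemma standing_pgroup : p.-group G. Proof. by case: stG => -[]. Qed.
Lemma standing_abelem : p.-abelem G^`(1). Proof. by case: stG. Qed.
Lemma standing_card : #|G^`(1)| = (p ^ 3)%N. Proof. by case: stG. Qed.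
Lemma standing_Phi : G^`(1) \subset 'Phi(G).
Proof. by rewrite (Phi_joing standing_pgroup) joing_subl. Qed.
Lemma standing_central : G^`(1) \subset 'Z(G).
Proof. by case: stG => _ sPZ _ _ _; apply: subset_trans standing_Phi sPZ. Qed.
Lemma standing_card_quotient : #|G / G^`(1)| = (p ^ m1 * p ^ m * p ^ m)%N.
Proof.
have [b bE] := abelian_structure (der_abelian 0 G); case: stG => _ _ _ _.
rewrite /= => -> /=; case: b bE => [|b1 [|b2 [|b3 [|]]]] //= bE [o1 o2 o3].
have := bigdprod_card bE.
by rewrite !big_cons big_nil muln1 -!orderE o1 o2 o3 mulnA => <-.
Qed.

Implicit Types (a b g h : gT).

Let abelG' := standing_abelem.
Let cenG' := standing_central.
Let der1_sub := subsetP (der_sub 1 G).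
Let pk_gt0 k : 0 < (p ^ k)%N. Proof. by rewrite expn_gt0 prime_gt0. Qed.
Let m1_gt0 : 0 < m1. Proof. exact: ltn_trans m_lt_m1. Qed.

Lemma row_der1 a1 a2 a3 (r1 r2 r3 : 'F_p) : a1 \in G -> a2 \in G -> a3 \in G ->
  phi [~ a2, a3] [~ a3, a1] [~ a1, a2] r1 r2 r3 \in G^`(1).
Proof. by move=> *; rewrite phi_mem ?der1_comm. Qed.

Lemma characteristic_generatorsE w a1 a2 a3 :
  characteristic_generators m1 m m G w a1 a2 a3 <-> gen_rows w a1 a2 a3.
Proof.
split=> [[[Ga1 Ga2 Ga3] defA _ rows] | [[Ga1 Ga2 Ga3] genG rows]].
  by split=> //; apply: abelianization_dprod_gen defA => //; exact: standing_Phi.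
case: (rows) => R1 R2 R3.
have [||||||dE oE] := abelianization_dprod Ga1 Ga2 Ga3 genG standing_card_quotient;
  by rewrite ?R1 ?R2 ?R3 ?row_der1.
Qed.

Lemma der1_gen a1 a2 a3 : a1 \in G -> a2 \in G -> a3 \in G -> <<[set a1; a2; a3]>> = G ->
  <<[set [~ a2, a3]; [~ a3, a1]; [~ a1, a2]]>> = G^`(1).
Proof.
move=> Ga1 Ga2 Ga3 genG; 
have [[Gx Gy] Gz] := (der1_comm Ga2 Ga3, der1_comm Ga3 Ga1, der1_comm Ga1 Ga2).
set S := [set _; _; _]; apply/eqP; rewrite eqEsubset gen_subG; apply/andP; split.
  by rewrite !subUset !sub1set Gx Gy.
have Sphi r1 r2 r3 : phi [~ a2, a3] [~ a3, a1] [~ a1, a2] (r1 : 'F_p) r2 r3 \in <<S>>.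
  by rewrite !groupM // groupX // mem_gen // !inE eqxx ?orbT.
rewrite gen_subG; apply/subsetP=> _ /imset2P[u v Gu Gv ->].
have defA := abelianization_gen Ga1 Ga2 Ga3 genG.
have [i1 [i2 [i3 [g [G'g ->]]]]] := abelianization_elt Ga1 Ga2 Ga3 defA Gu.
have [j1 [j2 [j3 [h [G'h ->]]]]] := abelianization_elt Ga1 Ga2 Ga3 defA Gv.
by rewrite (comm_comb p_prime abelG' cenG').
Qed.

Lemma comb_exp a1 a2 a3 i j k h n : a1 \in G -> a2 \in G -> a3 \in G -> h \in G^`(1) ->
  p %| n -> p %| 'C(n, 2) ->
  comb a1 a2 a3 i j k h ^+ n = (a1 ^+ n) ^+ i * (a2 ^+ n) ^+ j * (a3 ^+ n) ^+ k.
Proof.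
move=> Ga1 Ga2 Ga3 G'h pn pC; rewrite /comb.
have e (u v : gT) : u \in G -> v \in G -> (u * v) ^+ n = u ^+ n * v ^+ n.
  by move=> Gu Gv; apply: (expMg_class2 p_prime abelG' cenG').
have [G1 G2 G3] : [/\ a1 ^+ i \in G, a2 ^+ j \in G & a3 ^+ k \in G] by rewrite !groupX.
rewrite (e _ _ (groupM (groupM G1 G2) G3) (der1_sub G'h)).
rewrite (der1_exp p_prime abelG' G'h pn) mulg1.
rewrite (e _ _ (groupM G1 G2) G3) (e _ _ G1 G2).
by rewrite (expgAC a1) (expgAC a2) (expgAC a3).
Qed.

(** As m < m1, the p^m1-th powers of a2 and a3 are p-th powers of elements of G', hence trivial;
    only row 1 contributes. *)
Lemma gen_rows_exp w a1 a2 a3 i j k h : gen_rows w a1 a2 a3 -> h \in G^`(1) ->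
  let ph := phi [~ a2, a3] [~ a3, a1] [~ a1, a2] in
  comb a1 a2 a3 i j k h ^+ (p ^ m1) =
    ph (i%:R * w (idx 1) (idx 1))%R (i%:R * w (idx 1) (idx 2))%R (i%:R * w (idx 1) (idx 3))%R.
Proof.
move=> [[Ga1 Ga2 Ga3] _ [R1 R2 R3]] G'h ph.
have [[Gx Gy] Gz] := (der1_comm Ga2 Ga3, der1_comm Ga3 Ga1, der1_comm Ga1 Ga2).
have pm1 : (p ^ m1)%N = (p ^ m * p ^ (m1 - m))%N by rewrite -expnD subnKC // ltnW.
have pq : p %| (p ^ (m1 - m))%N by rewrite dvdn_exp // subn_gt0.
have a_1 (a : gT) : a ^+ (p ^ m) \in G^`(1) -> a ^+ (p ^ m1) = 1.
  by move=> G'a; rewrite pm1 expgM (der1_exp p_prime abelG' G'a pq).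
rewrite comb_exp ?dvdn_exp ?dvdn_bin2_prime_power //; last first.
  by move=> p2; apply: leq_trans (m_gt1 p2) (ltnW m_lt_m1).
rewrite (a_1 a2) ?R2 ?row_der1 // (a_1 a3) ?R3 ?row_der1 // !expg1n !mulg1 R1.
by rewrite /ph (phiZ p_prime abelG') // (abelem_expF p_prime abelG') // row_der1.
Qed.

(** The factor p^(m1 - m) completes p^m to p^m1, so the power of a1 contributes i times row 1. *)
Lemma gen_rows_exp2 w a1 a2 a3 i j k h : gen_rows w a1 a2 a3 -> h \in G^`(1) ->
  let ph := phi [~ a2, a3] [~ a3, a1] [~ a1, a2] in
  let lc l := (i%:R * w (idx 1) (idx l) + j%:R * w (idx 2) (idx l)
               + k%:R * w (idx 3) (idx l))%R in
  comb a1 a2 a3 (p ^ (m1 - m) * i) j k h ^+ (p ^ m) = ph (lc 1%N) (lc 2%N) (lc 3%N).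
Proof.
move=> [[Ga1 Ga2 Ga3] _ [R1 R2 R3]] G'h ph lc.
have [[Gx Gy] Gz] := (der1_comm Ga2 Ga3, der1_comm Ga3 Ga1, der1_comm Ga1 Ga2).
rewrite comb_exp ?dvdn_exp ?dvdn_bin2_prime_power //.
rewrite expgM -(expgM a1) -expnD subnKC 1?ltnW // R1 R2 R3 /lc /ph.
rewrite !(phiD p_prime abelG') // !(phiZ p_prime abelG') //.
by rewrite !(abelem_expF p_prime abelG') ?row_der1.
Qed.

End Standing.

(** * Matrix form of a change of generators *)

Section Cofactor.
Local Open Scope ring_scope.
Variable R : comNzRingType.
Variables (s b11 b12 b21 b22 c1 c2 : R).
Let d := b11 * b22 - b12 * b21.

(** The adjugate of the right factor in [mxrel]. Its rows are the cross products of the exponent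
    vectors (s, c1, c2), (0, b11, b12), (0, b21, b22), that is, the coordinates of the new
    commutators. *)
Definition cof : 'M[R]_3 :=
  mk d 0 0 (b21 * c2 - b22 * c1) (b22 * s) (- (b21 * s))
     (c1 * b12 - c2 * b11) (- (s * b12)) (s * b11).

Lemma cof_mulr : cof *m mk s 0 0 c1 b11 b21 c2 b12 b22 = (s * d)%:M.
Proof. by rewrite /cof mk_mul mk_scalar /d; congr mk; ring. Qed.

Lemma cof_mull : mk s 0 0 c1 b11 b21 c2 b12 b22 *m cof = (s * d)%:M.
Proof. by rewrite /cof mk_mul mk_scalar /d; congr mk; ring. Qed.

End Cofactor.

Section PhiRow.
Variables (p : nat) (gT : finGroupType) (x y z : gT).
Variables a11 a12 a13 a21 a22 a23 a31 a32 a33 : 'F_p.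
Let M := mk a11 a12 a13 a21 a22 a23 a31 a32 a33.

Lemma phi_row1 : phi_row x y z M 1 = phi x y z a11 a12 a13.
Proof. by rewrite /phi_row !mxE /= !inordK. Qed.

Lemma phi_row2 : phi_row x y z M 2 = phi x y z a21 a22 a23.
Proof. by rewrite /phi_row !mxE /= !inordK. Qed.

Lemma phi_row3 : phi_row x y z M 3 = phi x y z a31 a32 a33.
Proof. by rewrite /phi_row !mxE /= !inordK. Qed.

End PhiRow.

Section Standing.
Local Open Scope group_scope.
Variables (p m1 m : nat) (gT : finGroupType) (G : {group gT}).
Hypotheses (p_prime : prime p) (m_gt0 : 0 < m) (m_lt_m1 : m < m1)
  (m_gt1 : p = 2 -> 1 < m) (stG : standing p m1 m m G).

Implicit Types (a b g h : gT) (w : 'M['F_p]_3).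
Let abelG' := standing_abelem stG.
Let cenG' := standing_central stG.
Let pq : p %| (p ^ (m1 - m))%N. Proof. by rewrite dvdn_exp // subn_gt0. Qed.
Let q0 : (p ^ (m1 - m))%:R%R = 0%R :> 'F_p.
Proof. by apply/eqP; rewrite natFp_eq0. Qed.

(** The exponents p^(m1 - m) k1 and p^(m1 - m) k2 vanish modulo p in commutators but survive in
    p^m-th powers; c1 and c2 behave the other way round. So k occurs only in V and c only in K. *)
Lemma gen_rows_comb w a1 a2 a3 (s c1 c2 k1 b11 b12 k2 b21 b22 : nat) h1 h2 h3 :
  let a1' := comb a1 a2 a3 s c1 c2 h1 in
  let a2' := comb a1 a2 a3 (p ^ (m1 - m) * k1) b11 b12 h2 in
  let a3' := comb a1 a2 a3 (p ^ (m1 - m) * k2) b21 b22 h3 in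
  let row := phi_row [~ a2, a3] [~ a3, a1] [~ a1, a2] in
  let K := (cof s%:R b11%:R b12%:R b21%:R b22%:R c1%:R c2%:R : 'M['F_p]_3)%R in
  let V := (mk s%:R 0 0 k1%:R b11%:R b12%:R k2%:R b21%:R b22%:R *m w)%R in
  gen_rows m1 m G w a1 a2 a3 -> h1 \in G^`(1) -> h2 \in G^`(1) -> h3 \in G^`(1) ->
  [/\ [/\ [~ a2', a3'] = row K 1%N, [~ a3', a1'] = row K 2%N & [~ a1', a2'] = row K 3%N]
    & [/\ a1' ^+ (p ^ m1) = row V 1%N, a2' ^+ (p ^ m) = row V 2%N
        & a3' ^+ (p ^ m) = row V 3%N]].
Proof.
move=> a1' a2' a3' row K V gr G'h1 G'h2 G'h3; have [[Ga1 Ga2 Ga3] _ _] := gr.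
have VE : V = _ := etrans (congr1 (mulmx _) (mk_eta w))
  (mk_mul _ _ _ _ _ _ _ _ _ _ _ _ _ _ _ _ _ _).
rewrite /a1' /a2' /a3'; split; split.
- rewrite (comm_comb p_prime abelG' cenG') // /row /K /cof phi_row1 !natrM q0 /=.
  by congr phi; ring.
- rewrite (comm_comb p_prime abelG' cenG') // /row /K /cof phi_row2 !natrM q0 /=.
  by congr phi; ring.
- rewrite (comm_comb p_prime abelG' cenG') // /row /K /cof phi_row3 !natrM q0 /=.
  by congr phi; ring.
- rewrite (gen_rows_exp p_prime m_gt0 m_lt_m1 m_gt1 stG _ _ _ gr) // /row VE phi_row1.
  by congr phi; ring.
- rewrite (gen_rows_exp2 p_prime m_gt0 m_lt_m1 m_gt1 stG _ _ _ gr) // /row VE phi_row2.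
  by congr phi.
- rewrite (gen_rows_exp2 p_prime m_gt0 m_lt_m1 m_gt1 stG _ _ _ gr) // /row VE phi_row3.
  by congr phi.
Qed.

End Standing.

Section PhiRowMul.
Local Open Scope group_scope.
Variables (p : nat) (gT : finGroupType) (E : {group gT}) (x y z : gT).
Hypotheses (p_prime : prime p) (abelE : p.-abelem E).
Hypotheses (Ex : x \in E) (Ey : y \in E) (Ez : z \in E).
Implicit Types (W K : 'M['F_p]_3).

Lemma sum_idx (V : nmodType) (f : 'I_3 -> V) :
  (\sum_k f k = f (idx 1) + f (idx 2) + f (idx 3))%R.
Proof.
rewrite !big_ord_recl big_ord0 addr0 addrA.
by congr (f _ + f _ + f _)%R; apply/val_inj; rewrite /= inordK.
Qed.

Lemma phi_row_mul W K i :
  phi_row (phi_row x y z K 1) (phi_row x y z K 2) (phi_row x y z K 3) W i =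
  phi_row x y z (W *m K)%R i.
Proof. by rewrite /phi_row (phi_comp p_prime abelE) // !mxE !sum_idx. Qed.

Lemma phi_row_inj W K : <<[set x; y; z]>> = E -> #|E| = (p ^ 3)%N ->
  [/\ phi_row x y z W 1 = phi_row x y z K 1, phi_row x y z W 2 = phi_row x y z K 2
    & phi_row x y z W 3 = phi_row x y z K 3] -> W = K.
Proof.
move=> genE cE [E1 E2 E3]; rewrite [W]mk_eta [K]mk_eta.
have inj := phi_inj p_prime abelE Ex Ey Ez genE cE.
by have [-> -> ->] := inj _ _ _ _ _ _ E1; have [-> -> ->] := inj _ _ _ _ _ _ E2;
  have [-> -> ->] := inj _ _ _ _ _ _ E3.
Qed.

End PhiRowMul.

(** * The characteristic matrices of one group and the relation [mxrel] *)

Section Standing.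
Local Open Scope group_scope.
Variables (p m1 m : nat) (gT : finGroupType) (G : {group gT}).
Hypotheses (p_prime : prime p) (m_gt0 : 0 < m) (m_lt_m1 : m < m1)
  (m_gt1 : p = 2 -> 1 < m) (stG : standing p m1 m m G).

Implicit Types (a b g h : gT) (w : 'M['F_p]_3).
Let abelG' := standing_abelem stG.
Let pq : p %| (p ^ (m1 - m))%N. Proof. by rewrite dvdn_exp // subn_gt0. Qed.

Lemma gen_rows_relate w w' a1 a2 a3 b1 b2 b3 :
  gen_rows m1 m G w a1 a2 a3 -> gen_rows m1 m G w' b1 b2 b3 -> mxrel w w'.
Proof.
move=> ga gb; have [[Ga1 Ga2 Ga3] genG Ra] := ga; have [[Gb1 Gb2 Gb3] genG' Rb] := gb.
have defA := abelianization_gen Ga1 Ga2 Ga3 genG.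
have [_ _ [o1 _ _] _] := (characteristic_generatorsE p_prime stG w a1 a2 a3).2 ga.
(* If b^(p^m) lies in G', then so does a1^(p^m i), and a1 has order p^m1 modulo G'. *)
have q_dvd b i j k h : h \in G^`(1) -> b = comb a1 a2 a3 i j k h -> b ^+ (p ^ m) \in G^`(1) ->
    exists i', i = (p ^ (m1 - m) * i')%N.
  move=> G'h ->; have pm : p %| (p ^ m)%N by rewrite dvdn_exp.
  have pC : p %| 'C(p ^ m, 2) by apply: dvdn_bin2_prime_power.
  rewrite (comb_exp p_prime stG _ _ _ Ga1 Ga2 Ga3 G'h pm pC).
  case: Ra => R1 R2 R3; rewrite !(groupMr _ (groupX _ _)) ?R2 ?R3 ?row_der1 //.
  rewrite -expgM => G'a.
  have : #[coset G^`(1) a1] %| (p ^ m * i)%N.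
    by rewrite order_dvdn -morphX ?der1_norm //; apply/eqP; apply: coset_id.
  have pm1 : (p ^ m1)%N = (p ^ m * p ^ (m1 - m))%N by rewrite -expnD subnKC // ltnW.
  rewrite o1 pm1 dvdn_pmul2l ?expn_gt0 ?prime_gt0 //.
  by case/dvdnP=> i' ->; exists i'; rewrite mulnC.
have [s [c1 [c2 [h1 [G'h1 b1E]]]]] := abelianization_elt Ga1 Ga2 Ga3 defA Gb1.
have [i2 [b11 [b12 [h2 [G'h2 b2E]]]]] := abelianization_elt Ga1 Ga2 Ga3 defA Gb2.
have [i3 [b21 [b22 [h3 [G'h3 b3E]]]]] := abelianization_elt Ga1 Ga2 Ga3 defA Gb3.
have [_ Rb2 Rb3] := Rb.
have [|k1 i2E] := q_dvd _ _ _ _ _ G'h2 b2E; first by rewrite Rb2 row_der1.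
have [|k2 i3E] := q_dvd _ _ _ _ _ G'h3 b3E; first by rewrite Rb3 row_der1.
have := gen_rows_comb p_prime m_gt0 m_lt_m1 m_gt1 stG s c1 c2 k1 b11 b12 k2 b21 b22
  ga G'h1 G'h2 G'h3.
rewrite /comb -i2E -i3E -b1E -b2E -b3E /=.
set K := cof _ _ _ _ _ _ _; set Y := mk _ _ _ _ _ _ _ _ _.
have [Gx Gy Gz] : [/\ [~ a2, a3] \in G^`(1), [~ a3, a1] \in G^`(1) & [~ a1, a2] \in G^`(1)].
  by rewrite !der1_comm.
have [Gx' Gy' Gz'] : [/\ [~ b2, b3] \in G^`(1), [~ b3, b1] \in G^`(1) & [~ b1, b2] \in G^`(1)].
  by rewrite !der1_comm.
have injG' := phi_row_inj p_prime abelG' Gx Gy Gz (der1_gen p_prime stG Ga1 Ga2 Ga3 genG)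
  (standing_card stG).
have injG'' := phi_row_inj p_prime abelG' Gx' Gy' Gz' (der1_gen p_prime stG Gb1 Gb2 Gb3 genG')
  (standing_card stG).
move=> [[Ex Ey Ez] Rb']; have Emul W i : phi_row [~ b2, b3] [~ b3, b1] [~ b1, b2] W i =
    phi_row [~ a2, a3] [~ a3, a1] [~ a1, a2] (W *m K)%R i.
  by rewrite Ex Ey Ez (phi_row_mul p_prime abelG').
(* Both sides give the coordinates, in the old commutators, of the prescribed powers of the new
   generators. *)
have YwE : (w' *m K = Y *m w)%R.
  by apply: injG'; rewrite -!Emul; case: Rb Rb' => <- <- <- [<- <- <-].
exists s%:R%R, b11%:R%R, b12%:R%R, b21%:R%R, b22%:R%R, k1%:R%R, k2%:R%R, c1%:R%R, c2%:R%R.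
rewrite -/Y; set Z := mk _ _ _ _ _ _ _ _ _; set d := (_ - _)%R.
have KZ : (K *m Z = (s%:R * d)%:M)%R by exact: cof_mulr.
have ZK : (Z *m K = (s%:R * d)%:M)%R by exact: cof_mull.
have K_inj (W : 'M['F_p]_3) : (W *m K = 0 -> W = 0)%R.
  by move=> WK0; apply: injG''; rewrite !Emul WK0 mul0mx.
(* The new commutators are a basis of G' as well, so multiplication by K is injective. If s d = 0,
   then Z K = 0 gives Z = 0, hence K = 0, which is absurd. *)
have : (s%:R * d != 0 :> 'F_p)%R.
  apply/eqP=> sd0; rewrite sd0 raddf0 in ZK.
  have := K_inj _ ZK; rewrite mk0 => /mk_inj[[s0 _ _] [c10 b110 b210] [c20 b120 b220]].
  have K0 : K = 0%R.
    rewrite /K /cof s0 c10 b110 b210 c20 b120 b220 mk0.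
    by rewrite !(mul0r, mulr0, subr0, oppr0).
  have /matrixP/(_ (idx 1) (idx 1)) := K_inj 1%:M%R (etrans (mul1mx K) K0).
  by rewrite !mxE eqxx => /eqP; rewrite oner_eq0.
rewrite mulf_eq0 negb_or => /andP[s0 d0]; split=> //.
by rewrite -YwE -mulmxA KZ mul_mx_scalar.
Qed.

Lemma gen_rows_realise w w' a1 a2 a3 :
  gen_rows m1 m G w a1 a2 a3 -> mxrel w w' ->
  exists b1 b2 b3, gen_rows m1 m G w' b1 b2 b3.
Proof.
move=> ga [s [b11 [b12 [b21 [b22 [k1 [k2 [c1 [c2 [s0 d0 E]]]]]]]]]].
have [[Ga1 Ga2 Ga3] genG Ra] := ga.
have natF (r : 'F_p) : (r : nat)%:R%R = r by exact: natr_Zp.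
have := gen_rows_comb p_prime m_gt0 m_lt_m1 m_gt1 stG s c1 c2 k1 b11 b12 k2 b21 b22
  ga (group1 _) (group1 _) (group1 _).
rewrite !natF /=.
set b1 := comb a1 a2 a3 s _ _ _; set b2 := comb a1 a2 a3 (_ * k1) _ _ _.
set b3 := comb a1 a2 a3 (_ * k2) _ _ _.
set K := cof _ _ _ _ _ _ _; set Y := mk _ _ _ _ _ _ _ _ _.
move=> [[Ex Ey Ez] [R1 R2 R3]]; exists b1, b2, b3.
have [Gx Gy Gz] : [/\ [~ a2, a3] \in G^`(1), [~ a3, a1] \in G^`(1) & [~ a1, a2] \in G^`(1)].
  by rewrite !der1_comm.
have [Gb1 Gb2 Gb3] : [/\ b1 \in G, b2 \in G & b3 \in G] by rewrite !comb_mem.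
set d := (_ - _)%R in E d0; have sd0 : (s * d != 0)%R by rewrite mulf_neq0.
(* Multiply [E] by K on the right and cancel s d. *)
have YwE : (w' *m K = Y *m w)%R.
  have := congr1 (mulmx^~ K) E; rewrite -!mulmxA cof_mull mul_mx_scalar -scalemxAl -/Y.
  by rewrite -scalemxAr; apply: (scalerI sd0).
split=> //; last first.
  rewrite /= Ex Ey Ez !(phi_row_mul p_prime abelG') // YwE.
  by split; [exact: R1 | exact: R2 | exact: R3].
set Z := mk s 0 0 c1 b11 b21 c2 b12 b22 in E.
have ZK : (Z *m K = (s * d)%:M)%R by exact: cof_mull.
pose f := coset 'Phi(G); pose Q := (G / 'Phi(G))%G.
have NPhi g : g \in G -> g \in 'N('Phi(G)) by apply: (subsetP (normal_norm (Phi_normal G))).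
have abelQ : p.-abelem Q := Phi_quotient_abelem (standing_pgroup stG).
have [Qa1 Qa2 Qa3] : [/\ f a1 \in Q, f a2 \in Q & f a3 \in Q] by rewrite !mem_quotient.
have fcomb i j k : f (comb a1 a2 a3 i j k 1) = f a1 ^+ i * f a2 ^+ j * f a3 ^+ k.
  by rewrite /comb mulg1 /f !morphM ?morphX ?groupM ?groupX ?NPhi.
have fq (k : nat) : f a1 ^+ (p ^ (m1 - m) * k) = 1.
  have [t ->] := dvdnP pq; rewrite mulnAC mulnC expgM.
  by case/abelemP: abelQ => // _ /(_ _ Qa1) ->; rewrite expg1n.
have fb : [/\ f b1 = phi_row (f a1) (f a2) (f a3) Z^T%R 1,
    f b2 = phi_row (f a1) (f a2) (f a3) Z^T%R 2 & f b3 = phi_row (f a1) (f a2) (f a3) Z^T%R 3].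
  rewrite /b1 /b2 /b3 !fcomb !fq; split; rewrite /phi_row !mxE /= !inordK //.
(* Modulo the Frattini subgroup the new generators have coordinate matrix Z^T. Its inverse X comes
   from transposing Z K = s d and expresses the old generators through the new ones. *)
pose X := ((s * d)^-1 *: K^T)%R.
have XZ : (X *m Z^T = 1%:M)%R.
  by rewrite -scalemxAl -trmx_mul ZK tr_scalar_mx scale_scalar_mx mulVf.
have a_row : [/\ f a1 = phi_row (f b1) (f b2) (f b3) X 1,
    f a2 = phi_row (f b1) (f b2) (f b3) X 2
    & f a3 = phi_row (f b1) (f b2) (f b3) X 3].
  case: fb => -> -> ->; rewrite !(phi_row_mul p_prime abelQ) // XZ.
  by rewrite mk_scalar phi_row1 phi_row2 phi_row3 /phi !expg0 !mulg1 !mul1g.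
apply: Phi_nongen; apply/eqP.
rewrite eqEsubset join_subG Phi_sub !subUset !sub1set Gb1 Gb2 Gb3 /=.
suff: <<[set a1; a2; a3]>> \subset 'Phi(G) <*> [set b1; b2; b3] by rewrite genG.
rewrite gen_subG !subUset !sub1set.
clearbody b1 b2 b3.
have inL a i : a \in G -> f a = phi_row (f b1) (f b2) (f b3) X i ->
    a \in 'Phi(G) <*> [set b1; b2; b3].
  move=> Ga; set g :=
    b1 ^+ X (idx i) (idx 1) * b2 ^+ X (idx i) (idx 2) * b3 ^+ X (idx i) (idx 3).
  have Gg : g \in G by rewrite !groupM ?groupX.
  have -> : phi_row (f b1) (f b2) (f b3) X i = f g.
    by rewrite /f /g !morphM ?morphX ?groupM ?groupX ?NPhi.
  move=> fa; have Phi_ag : a * g^-1 \in 'Phi(G).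
    apply: coset_idr; first by rewrite NPhi ?groupM ?groupV.
    by rewrite morphM ?morphV ?groupV ?NPhi //= [coset _ a]fa mulgV.
  rewrite -(mulgKV g a) groupM //; first by rewrite mem_gen // inE Phi_ag.
  by rewrite !groupM // groupX // mem_gen // !inE eqxx ?orbT.
by case: a_row => /(inL _ _ Ga1) -> /(inL _ _ Ga2) -> /(inL _ _ Ga3) ->.
Qed.

Lemma gen_rows_exists : exists (w : 'M['F_p]_3) a1 a2 a3, gen_rows m1 m G w a1 a2 a3.
Proof.
have [b bE] := abelian_structure (der_abelian 0 G); case: stG => _ _ _ _.
rewrite /= => -> /=; case: b bE => [|b1 [|b2 [|b3 [|]]]] //= bE [o1 o2 o3].
move: bE; rewrite !big_cons big_nil dprodg1 dprodA => defA.
have [[K L defK defL] KL _ _] := dprodP defA.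
have Kb : <[b1]> * <[b2]> = K by rewrite -(dprodW defK).
have Ab i : i \in G / G^`(1) -> exists2 a, a \in G & i = coset G^`(1) a.
  by case/morphimP=> a _ Ga ->; exists a.
have Kb1 : b1 \in K by rewrite -Kb (subsetP (mulG_subl _ _)) ?cycle_id.
have Kb2 : b2 \in K by rewrite -Kb (subsetP (mulG_subr _ _)) ?cycle_id.
have [a1 Ga1 b1E] : exists2 a, a \in G & b1 = coset G^`(1) a.
  by apply: Ab; rewrite -KL defK (subsetP (mulG_subl _ _)).
have [a2 Ga2 b2E] : exists2 a, a \in G & b2 = coset G^`(1) a.
  by apply: Ab; rewrite -KL defK (subsetP (mulG_subl _ _)).
have [a3 Ga3 b3E] : exists2 a, a \in G & b3 = coset G^`(1) a.
  by apply: Ab; rewrite -KL defK (subsetP (mulG_subr _ _)) ?cycle_id.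
rewrite b1E b2E b3E in defA o1 o2 o3.
have genG := abelianization_dprod_gen Ga1 Ga2 Ga3 (standing_Phi stG) defA.
have [Gx Gy Gz] : [/\ [~ a2, a3] \in G^`(1), [~ a3, a1] \in G^`(1) & [~ a1, a2] \in G^`(1)].
  by rewrite !der1_comm.
have rowP a n : a \in G -> #[coset G^`(1) a] = n -> exists r1 r2 r3 : 'F_p,
    a ^+ n = phi [~ a2, a3] [~ a3, a1] [~ a1, a2] r1 r2 r3.
  move=> Ga on.
  apply: (phi_surj p_prime abelG' Gx Gy Gz (der1_gen p_prime stG Ga1 Ga2 Ga3 genG)).
  apply: coset_idr; first by rewrite der1_norm ?groupX.
  by rewrite morphX ?der1_norm //= -on expg_order.
have [w11 [w12 [w13 R1]]] := rowP _ _ Ga1 o1.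
have [w21 [w22 [w23 R2]]] := rowP _ _ Ga2 o2.
have [w31 [w32 [w33 R3]]] := rowP _ _ Ga3 o3.
exists (mk w11 w12 w13 w21 w22 w23 w31 w32 w33), a1, a2, a3; split=> //.
by rewrite /= phi_row1 phi_row2 phi_row3.
Qed.

End Standing.

Lemma characteristic_matrixE p m1 m (gT : finGroupType) (G : {group gT}) (w : 'M['F_p]_3) :
  prime p -> standing p m1 m m G ->
  characteristic_matrix m1 m m G w <-> exists a1 a2 a3, gen_rows m1 m G w a1 a2 a3.
Proof.
move=> pp st; split=> -[a1 [a2 [a3 H]]]; exists a1, a2, a3;
  exact/(characteristic_generatorsE pp st).
Qed.

Lemma gen_rows_isog p m1 m (gT hT : finGroupType) (G : {group gT}) (H : {group hT})
    (w : 'M['F_p]_3) a1 a2 a3 :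
  (G \isog H)%g -> gen_rows m1 m G w a1 a2 a3 ->
  exists b1 b2 b3, gen_rows m1 m H w b1 b2 b3.
Proof.
case/isogP=> f injf fG [[Ga1 Ga2 Ga3] genG [R1 R2 R3]].
exists (f a1), (f a2), (f a3).
have cX u v (n : nat) : u \in G -> v \in G -> ([~ u, v] ^+ n \in G)%g.
  by move=> Gu Gv; rewrite groupX ?groupR.
have f_row i : f (phi_row [~ a2, a3] [~ a3, a1] [~ a1, a2] w i)%g =
  phi_row [~ f a2, f a3]%g [~ f a3, f a1]%g [~ f a1, f a2]%g w i.
  rewrite /phi_row /phi !morphM ?morphX ?morphR ?groupR //;
    by rewrite ?cX // groupM ?cX.
split.
- by rewrite -fG !mem_morphim.
- rewrite -fG -(congr1 (fun K : {set gT} => f @* K)%g genG) morphim_gen; last first.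
    by rewrite !subUset !sub1set Ga1 Ga2.
  rewrite morphimEsub; last by rewrite !subUset !sub1set Ga1 Ga2.
  by rewrite !imsetU !imset_set1.
- by rewrite /= -!f_row -R1 -R2 -R3 !morphX.
Qed.

(** * Groups with a given characteristic matrix *)

Section CentralExtension.
Local Open Scope ring_scope.
Variables (A V : finZmodType).

Definition cocycle (f : A -> A -> V) :=
  (forall a, f 0 a = 0) /\ forall a b c, f a b + f (a + b) c = f b c + f a (b + c).

(** The proof [fC] is a parameter of the type so that a group structure can be attached to it. *)
Definition cext (f : A -> A -> V) (fC : cocycle f) : Type := (A * V)%type.

Variables (f : A -> A -> V) (fC : cocycle f).
Implicit Types x y z : cext fC.

HB.instance Definition _ := Finite.on (cext fC).

Definition cext_mul x y : cext fC := (x.1 + y.1, x.2 + y.2 + f x.1 y.1).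
Definition cext_one : cext fC := (0, 0).
Definition cext_inv x : cext fC := (- x.1, - x.2 - f (- x.1) x.1).

Lemma cocycle0r a : f a 0 = 0.
Proof.
case: fC => f0 fA; have := fA a 0 0.
by rewrite !addr0 f0 add0r -[RHS]addr0 => /addrI.
Qed.

Lemma cext_mulA : associative cext_mul.
Proof.
move=> [a u] [b v] [c t]; rewrite /cext_mul /=; congr (_, _); first exact: addrA.
have [_ /(_ a b c) E] := fC.
transitivity (u + v + t + (f b c + f a (b + c))); first by rewrite !addrA.
by rewrite -E !addrA; congr (_ + _); apply: addrAC.
Qed.

Lemma cext_mul1 : left_id cext_one cext_mul.
Proof. by case=> a u; rewrite /cext_mul /= !add0r fC.1 addr0. Qed.

Lemma cext_mulV : left_inverse cext_one cext_inv cext_mul.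
Proof. by case=> a u; rewrite /cext_mul /= addNr addrAC subrK addNr. Qed.

HB.instance Definition _ :=
  Finite_isGroup.Build (cext fC) cext_mulA cext_mul1 cext_mulV.

Definition cext_fiber (u : V) : cext fC := (0, u).

Local Open Scope group_scope.

Lemma cext_mulE x y : x * y = ((x.1 + y.1)%R, (x.2 + y.2 + f x.1 y.1)%R).
Proof. by []. Qed.

Lemma cext_fiberM u v : cext_fiber u * cext_fiber v = cext_fiber (u + v)%R.
Proof. by rewrite cext_mulE /= fC.1 !addr0. Qed.

Lemma cext_fiberX u n : cext_fiber u ^+ n = cext_fiber (u *+ n)%R.
Proof. by elim: n => [//|n IHn]; rewrite expgS IHn cext_fiberM mulrS. Qed.

Lemma cext_fiber_central u x : commute (cext_fiber u) x.
Proof. by rewrite /commute !cext_mulE /= fC.1 cocycle0r !addr0 add0r addrC. Qed.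

Lemma cext_commgE x y : [~ x, y] = cext_fiber (f x.1 y.1 - f y.1 x.1)%R.
Proof.
apply: (mulgI (y * x)); rewrite /commg /conjg !mulgA.
rewrite -!mulgA !mulKVg.
rewrite !cext_mulE /= cocycle0r !addr0; congr (_, _); first exact: addrC.
by rewrite !addrA subrK [(x.2 + y.2)%R]addrC.
Qed.

End CentralExtension.

(** * Carry cocycles of cyclic groups *)

Section Carry.
Local Open Scope ring_scope.
Variables (p n : nat).
Hypotheses (p_prime : prime p) (n_gt1 : (1 < n)%N) (p_dvd_n : (p %| n)%N).

Definition carry (a b : 'Z_n) : 'F_p := ((a + b)%N %/ n)%:R.
Definition redp (a : 'Z_n) : 'F_p := (a : nat)%:R.

Lemma val_ZpD (a b : 'Z_n) : (a + b)%R = ((a + b)%N %% n)%N :> nat.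
Proof. by rewrite /=; congr (_ %% _)%N; apply: Zp_cast. Qed.

Lemma ltn_Zp (a : 'Z_n) : (a < n)%N.
Proof. by apply: leq_trans (ltn_ord a) _; rewrite Zp_cast. Qed.

Lemma carry0l a : carry 0 a = 0.
Proof. by rewrite /carry add0n divn_small ?ltn_Zp. Qed.

Lemma carry0r a : carry a 0 = 0.
Proof. by rewrite /carry addn0 divn_small ?ltn_Zp. Qed.

(** Both sides count the multiples of n removed in all when a + b + c is reduced, namely the
    quotient of a + b + c by n. *)
Lemma carryA a b c : carry a b + carry (a + b) c = carry b c + carry a (b + c).
Proof.
rewrite /carry !val_ZpD -!natrD; congr _%:R.
have n0 : (0 < n)%N := ltnW n_gt1.
have E x y : (x %/ n + (x %% n + y) %/ n = (x + y) %/ n)%N.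
  by rewrite {3}(divn_eq x n) -addnA divnMDl.
rewrite E (_ : (a + b + c)%N = (b + c + a)%N); last by rewrite -addnA addnC.
by rewrite -E [((b + c) %% n + a)%N]addnC.
Qed.

Lemma redp0 : redp 0 = 0. Proof. by []. Qed.

Lemma redpD a b : redp (a + b) = redp a + redp b.
Proof.
rewrite /redp val_ZpD -natrD {2}(divn_eq (a + b) n) natrD natrM.
have /eqP -> : n%:R == 0 :> 'F_p by rewrite natFp_eq0.
by rewrite mulr0 add0r.
Qed.

End Carry.

HB.instance Definition _ (A B : finZmodType) := Finite.on (A * B)%type.

(** * The model group with matrix w *)

Section Model.
Variables (p m1 m : nat) (w : 'M['F_p]_3).
Hypotheses (p_prime : prime p) (m_gt0 : 0 < m) (m_lt_m1 : m < m1)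
  (m_gt1 : p = 2 -> 1 < m).
Let n1 := (p ^ m1)%N.
Let n := (p ^ m)%N.
Let A : finZmodType := ('Z_n1 * 'Z_n * 'Z_n)%type.
Let V : finZmodType := ('F_p * 'F_p * 'F_p)%type.

Let m1_gt0 : 0 < m1. Proof. exact: ltn_trans m_lt_m1. Qed.
Let n1_gt1 : 1 < n1. Proof. by rewrite -[1%N](exp1n m1) ltn_exp2r ?prime_gt1. Qed.
Let n_gt1 : 1 < n. Proof. by rewrite -[1%N](exp1n m) ltn_exp2r ?prime_gt1. Qed.
Let p_n1 : p %| n1. Proof. exact: dvdn_exp. Qed.
Let p_n : p %| n. Proof. exact: dvdn_exp. Qed.

Local Open Scope ring_scope.

Let VB (x y z x' y' z' : 'F_p) :
  (x, y, z) - (x', y', z') = (x - x', y - y', z - z') :> V.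
Proof. by []. Qed.
Let VD (x y z x' y' z' : 'F_p) :
  (x, y, z) + (x', y', z') = (x + x', y + y', z + z') :> V.
Proof. by []. Qed.
Let VX (x y z : 'F_p) k : (x, y, z) *+ k = (x *+ k, y *+ k, z *+ k) :> V.
Proof. by elim: k => [|k IHk] //; rewrite !mulrS IHk. Qed.
Let AD (x x' : 'Z_n1) (y z y' z' : 'Z_n) :
  (x, y, z) + (x', y', z') = (x + x', y + y', z + z') :> A.
Proof. by []. Qed.
Let AX (x : 'Z_n1) (y z : 'Z_n) k : (x, y, z) *+ k = (x *+ k, y *+ k, z *+ k) :> A.
Proof. by elim: k => [|k IHk] //; rewrite !mulrS IHk. Qed.

Definition model_coord (j : nat) (a b : A) : 'F_p :=
  carry p a.1.1 b.1.1 * w (idx 1) (idx j) + carry p a.1.2 b.1.2 * w (idx 2) (idx j)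
  + carry p a.2 b.2 * w (idx 3) (idx j).

(* The carries make a_i ^ (p ^ m_i) equal to row i of w, and the bilinear part
   makes [~ a2, a3], [~ a3, a1], [~ a1, a2] the standard basis of V. *)
Definition model_cocycle (a b : A) : V :=
  (model_coord 1 a b + redp p a.1.2 * redp p b.2,
   model_coord 2 a b + redp p a.2 * redp p b.1.1,
   model_coord 3 a b + redp p a.1.1 * redp p b.1.2).

(** The carry part and the bilinear part satisfy the identity separately, the latter because [redp]
    is additive. *)
Lemma model_cocycleP : cocycle model_cocycle.
Proof.
split=> [a|a b c].
  by rewrite /model_cocycle /model_coord !carry0l // !redp0 !mul0r !addr0.
have coordA j : model_coord j a b + model_coord j (a + b) c =
    model_coord j b c + model_coord j a (b + c).
  have E1 := carryA p n1_gt1 a.1.1 b.1.1 c.1.1.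
  have E2 := carryA p n_gt1 a.1.2 b.1.2 c.1.2.
  have E3 := carryA p n_gt1 a.2 b.2 c.2.
  rewrite /model_coord.
  transitivity ((carry p a.1.1 b.1.1 + carry p (a + b).1.1 c.1.1) * w (idx 1) (idx j)
    + (carry p a.1.2 b.1.2 + carry p (a + b).1.2 c.1.2) * w (idx 2) (idx j)
    + (carry p a.2 b.2 + carry p (a + b).2 c.2) * w (idx 3) (idx j)); first by ring.
  by rewrite [X in X * _ + _ + _]E1 [X in _ + X * _ + _]E2 [X in _ + X * _]E3 /=; ring.
have shuffle (x y x' y' u v u' v' : 'F_p) : x + x' = y + y' -> u + u' = v + v' ->
    (x + u) + (x' + u') = (y + v) + (y' + v').
  by move=> E E'; rewrite addrACA E E' addrACA.
by congr (_, _, _) => /=; apply: shuffle; rewrite ?coordA // !redpD //; ring.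
Qed.

Local Notation model := (cext model_cocycleP).
Let G := [set: model]%G.
Let fib (r1 r2 r3 : 'F_p) : model := cext_fiber model_cocycleP (r1, r2, r3).
Let a1 : model := ((1, 0, 0), 0).
Let a2 : model := ((0, 1, 0), 0).
Let a3 : model := ((0, 0, 1), 0).

Local Open Scope group_scope.

Lemma model_comm :
  [/\ [~ a2, a3] = fib 1 0 0, [~ a3, a1] = fib 0 1 0 & [~ a1, a2] = fib 0 0 1]%R.
Proof.
have r1 k : (1 < k)%N -> redp p (1 : 'Z_k)%R = 1%R by move=> k1; rewrite /redp.
rewrite !cext_commgE /= /model_cocycle /model_coord /=.
rewrite !carry0l ?carry0r // !redp0 !r1 // !VB.
by split; congr cext_fiber; congr (_, _, _); ring.
Qed.

Lemma model_phi r1 r2 r3 : phi [~ a2, a3] [~ a3, a1] [~ a1, a2] r1 r2 r3 = fib r1 r2 r3.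
Proof.
case: model_comm => -> -> ->; rewrite /phi /fib !cext_fiberX !cext_fiberM.
have natF (r : 'F_p) : (1 *+ r = r)%R by exact: natr_Zp.
by rewrite !VX !VD !mul0rn !natF !addr0 !add0r.
Qed.

Lemma model_exp : [/\ a1 ^+ (p ^ m1) = phi_row [~ a2, a3] [~ a3, a1] [~ a1, a2] w 1,
  a2 ^+ (p ^ m) = phi_row [~ a2, a3] [~ a3, a1] [~ a1, a2] w 2
  & a3 ^+ (p ^ m) = phi_row [~ a2, a3] [~ a3, a1] [~ a1, a2] w 3].
Proof.
rewrite /phi_row !model_phi.
have val1 k : (1 < k)%N -> (1 : 'Z_k)%R = 1%N :> nat by move=> k1.
have carry1 k j : (1 < k)%N -> (j%:R : 'Z_k)%R = (j %% k)%N :> nat.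
  by move=> k1; rewrite val_Zp_nat.
(* Along the powers of one generator the bilinear terms vanish and the carries add up to j %/ n1 or
   j %/ n, which first becomes 1 at the order of the generator modulo the fibre. *)
have row j : [/\ a1 ^+ j = ((j%:R, 0, 0), ((j %/ n1)%:R * w (idx 1) (idx 1),
    (j %/ n1)%:R * w (idx 1) (idx 2), (j %/ n1)%:R * w (idx 1) (idx 3)))%R,
   a2 ^+ j = ((0, j%:R, 0), ((j %/ n)%:R * w (idx 2) (idx 1),
    (j %/ n)%:R * w (idx 2) (idx 2), (j %/ n)%:R * w (idx 2) (idx 3)))%R
  & a3 ^+ j = ((0, 0, j%:R), ((j %/ n)%:R * w (idx 3) (idx 1),
    (j %/ n)%:R * w (idx 3) (idx 2), (j %/ n)%:R * w (idx 3) (idx 3)))%R].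
  elim: j => [|j [IH1 IH2 IH3]]; first by rewrite !div0n !mul0r.
  have S k : (1 < k)%N -> ((j.+1 %/ k)%:R = (j %/ k)%:R + carry p (j%:R : 'Z_k) 1 :> 'F_p)%R.
    move=> k1; rewrite /carry carry1 // val1 // -natrD; congr _%:R%R.
    by rewrite -divnMDl ?(ltnW k1) // addnA -divn_eq addn1.
  rewrite !expgSr IH1 IH2 IH3 !cext_mulE /= /model_cocycle /model_coord /=.
  rewrite !carry0l // !redp0 !addr0.
  rewrite !AD !VD !addr0 !natr1.
  by split; congr (_, (_, _, _)); rewrite ?(S n1) ?(S n) //; ring.
have n1_0 : (n1%:R = 0 :> 'Z_n1)%R by apply/val_inj; rewrite /= carry1 // modnn.
have n_0 : (n%:R = 0 :> 'Z_n)%R by apply/val_inj; rewrite /= carry1 // modnn.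
have [-> _ _] := row (p ^ m1)%N; have [_ -> ->] := row (p ^ m)%N.
by rewrite -/n1 -/n n1_0 n_0 !divnn !(ltnW n1_gt1, ltnW n_gt1) !mul1r.
Qed.

Let in_G (g : model) : g \in G. Proof. exact: in_setT. Qed.

Lemma model_fiberP (g h : model) : g.1 = h.1 -> exists r1 r2 r3, g = h * fib r1 r2 r3.
Proof.
move=> gh; have : (h^-1 * g).1 = 0%R.
  have hE : (h * (h^-1 * g)).1 = h.1 by rewrite mulKVg.
  by apply: (addrI h.1); rewrite addr0 -[RHS]hE cext_mulE.
case E: (h^-1 * g) => [a [[r1 r2] r3]] /= a0; exists r1, r2, r3.
by rewrite -[LHS](mulKVg h) E a0.
Qed.

Lemma model_der1 : G^`(1) = [set u : model | u.1 == 0%R].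
Proof.
have grp : group_set [set u : model | u.1 == 0%R].
  apply/group_setP; split=> [|u v]; first by rewrite inE.
  by rewrite !inE cext_mulE /= => /eqP-> /eqP->; rewrite addr0.
apply/eqP; rewrite eqEsubset; apply/andP; split.
  rewrite (gen_subG _ (Group grp)); apply/subsetP=> _ /imset2P[u v _ _ ->].
  by rewrite cext_commgE inE.
apply/subsetP=> u; rewrite inE => /eqP u0.
have [r1 [r2 [r3 ->]]] : exists r1 r2 r3, u = 1 * fib r1 r2 r3 by apply: model_fiberP.
by rewrite mul1g -model_phi !groupM ?groupX // mem_commg.
Qed.

Lemma model_gen : <<[set a1; a2; a3]>> = G.
Proof.
apply/setP=> g; rewrite in_setT; set S := <<_>>.
have [S1 S2 S3] : [/\ a1 \in S, a2 \in S & a3 \in S].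
  by split; apply: mem_gen; rewrite !inE eqxx ?orbT.
have fst1 : {morph (fun u : model => u.1) : u v / u * v >-> (u + v)%R} by [].
have fstX (u : model) k : (u ^+ k).1 = (u.1 *+ k)%R.
  by elim: k => [//|k IHk]; rewrite expgS mulrS -IHk.
case: g => [[[i j] k] t]; pose h := a1 ^+ i * a2 ^+ j * a3 ^+ k.
have Sh : h \in S by rewrite !groupM ?groupX.
have [r1 [r2 [r3 ->]]] : exists r1 r2 r3, (i, j, k, t) = h * fib r1 r2 r3.
  apply: model_fiberP; rewrite /h !fst1 !fstX /= !AX !AD !mul0rn !addr0 !add0r.
  by congr (_, _, _); apply/esym/natr_Zp.
rewrite groupM // -model_phi /phi /commg /conjg.
by rewrite !(groupM, groupX, groupV).
Qed.

Lemma model_card : #|G| = (n1 * n * n * p ^ 3)%N.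
Proof.
rewrite cardsT !card_prod card_Fp // !card_ord !Zp_cast //.
by rewrite !expnS expn0 muln1 !mulnA.
Qed.

Lemma model_card_der1 : #|G^`(1)| = (p ^ 3)%N.
Proof.
rewrite model_der1; transitivity #|[set cext_fiber model_cocycleP v | v : V]|.
  apply: eq_card => -[a v]; rewrite inE /=; apply/eqP/imsetP => [->|[v' _ [-> _]] //].
  by exists v.
rewrite card_imset; last by move=> u v [].
by rewrite card_prod card_prod card_Fp // !expnS expn0 muln1 mulnA.
Qed.

Lemma model_pgroup : p.-group G.
Proof. by rewrite /pgroup model_card !pnatM !pnatX pnat_id. Qed.

Lemma model_central : G^`(1) \subset 'Z(G).
Proof.
rewrite model_der1; apply/subsetP=> -[a v]; rewrite inE /= => /eqP->.
by apply/centerP; split=> // u _; apply: cext_fiber_central.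
Qed.

Lemma model_abelem : p.-abelem G^`(1).
Proof.
apply/abelemP=> //; split.
  exact: abelianS model_central (center_abelian G).
move=> u G'u; have : u \in G^`(1) by [].
rewrite model_der1 inE; case: u {G'u} => [a v] /= /eqP->; rewrite cext_fiberX.
have Vp (u : V) : (u *+ p = 0)%R.
  have Fp0 (x : 'F_p) : (x *+ p = 0)%R by rewrite -mulr_natr pchar_Fp_0 ?mulr0.
  by case: u => [[x y] z]; rewrite VX !Fp0.
by rewrite Vp.
Qed.

Lemma model_standing : standing p m1 m m G.
Proof.
have genG := model_gen; have pG := model_pgroup.
have row_der j : phi_row [~ a2, a3] [~ a3, a1] [~ a1, a2] w j \in G^`(1).
  by rewrite /phi_row model_phi model_der1 inE.
have cA : #|G / G^`(1)| = (n1 * n * n)%N.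
  rewrite card_quotient ?der_norm // -divgS ?der_sub // model_card model_card_der1.
  by rewrite mulnK // expn_gt0 prime_gt0.
have [R1 R2 R3] := model_exp.
have [||||||dA [o1 o2 o3]] := abelianization_dprod (in_G a1) (in_G a2) (in_G a3) genG cA;
  rewrite ?R1 ?R2 ?R3 ?row_der ?(ltnW n1_gt1) ?(ltnW n_gt1) //.
set b1 := coset _ a1 in dA o1; set b2 := coset _ a2 in dA o2; set b3 := coset _ a3 in dA o3.
have tA : abelian_type (G / G^`(1)) = [:: n1; n; n].
  have bA : \big[dprod/1]_(b <- [:: b1; b2; b3]) <[b]> = G / G^`(1).
    by rewrite !big_cons big_nil dprodg1 dprodA.
  have := abelian_type_pgroup (quotient_pgroup _ pG) bA; rewrite /= o1 o2 o3 => tA.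
  (* [tA] gives the type only up to permutation; sortedness of both lists fixes the order. *)
  apply: (sorted_eq (leT := geq)) (tA _).
  - by move=> x y z xy yz; apply: leq_trans yz xy.
  - by move=> x y /andP[xy yx]; apply/eqP; rewrite eqn_leq; apply/andP.
  - exact: abelian_type_sorted.
  - by rewrite /= leqnn andbT leq_exp2l ?prime_gt1 // ltnW.
  by rewrite !inE ![1 == _]eq_sym -!order_eq1 o1 o2 o3 !(gtn_eqF n1_gt1, gtn_eqF n_gt1).
have mG : 'm(G) = 3.
  (* Three generators suffice, and the abelian quotient G / G' already has type of length three. *)
  apply/eqP; rewrite eqn_leq; apply/andP; split.
    rewrite -[X in 'm(X)]genG; apply: leq_trans (grank_min _) _.
    by apply: leq_trans (leq_card_setU _ _) _; rewrite cards1 cards2; case: (_ == _).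
  apply: leq_trans (quotient_grank (der_norm 1 G)).
  by rewrite grank_abelian ?der_abelian // -size_abelian_type ?der_abelian // tA.
split=> //; [|exact: model_abelem|exact: model_card_der1].
rewrite (Phi_joing pG) join_subG model_central /= (MhoE _ pG) gen_subG.
(* The Frattini subgroup is generated by G' and the p-th powers, and u^p is central because [u^p, v]
   = [u, v]^p = 1. *)
apply/subsetP=> _ /imsetP[u _ ->]; apply/centerP; split=> // v _.
apply/commgP; rewrite (commXl model_central) // expn1.
by rewrite (der1_exp p_prime model_abelem) // mem_commg.
Qed.

Lemma model_characteristic : characteristic_matrix m1 m m G w.
Proof.
apply/(characteristic_matrixE w p_prime model_standing).
exists a1, a2, a3; split; [by [] | exact: model_gen |].
exact: model_exp.
Qed.

End Model.

Theorem theorem4p1 (p m1 m2 m3 : nat) (eta : 'F_p) (p_prime : prime p)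
  (m3_ge1 : 1 <= m3) (m2_eq_m3 : m2 = m3) (m2_lt_m1 : m2 < m1)
  (m2_gt1 : p = 2 -> 1 < m2)
  (eta_nonresidue : odd p -> forall s : 'F_p, (s ^+ 2)%R != eta) :
  [/\ (* every such group has a characteristic matrix in the list *)
      forall (gT : finGroupType) (G : {group gT}),
        standing p m1 m2 m3 G ->
        exists w : 'M['F_p]_3,
          listed eta w /\ characteristic_matrix m1 m2 m3 G w,
      (* every matrix in the list gives a group *)
      forall w : 'M['F_p]_3, listed eta w ->
        exists (gT : finGroupType) (G : {group gT}),
          standing p m1 m2 m3 G /\ characteristic_matrix m1 m2 m3 G w
    & (* different matrices give non-isomorphic groups *)
      forall (w w' : 'M['F_p]_3) (gT hT : finGroupType)
          (G : {group gT}) (H : {group hT}),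
        listed eta w -> listed eta w' -> w <> w' ->
        standing p m1 m2 m3 G -> standing p m1 m2 m3 H ->
        characteristic_matrix m1 m2 m3 G w ->
        characteristic_matrix m1 m2 m3 H w' ->
        ~~ (G \isog H)].
Proof.
have m_gt0 : 0 < m2 by rewrite m2_eq_m3.
subst m3; split.
- move=> gT G stG.
  have [w [a1 [a2 [a3 ga]]]] := gen_rows_exists p_prime stG.
  have [w' [lw' ww']] := listed_exists p_prime eta_nonresidue w.
  exists w'; split=> //; apply/(characteristic_matrixE w' p_prime stG).
  exact: (gen_rows_realise p_prime m_gt0 m2_lt_m1 m2_gt1 stG ga ww').
- move=> w _; do 2!eexists; split; first exact: model_standing.
  exact: model_characteristic.
move=> w w' gT hT G H lw lw' ww' stG stH.
move=> /(characteristic_matrixE w p_prime stG)[a1 [a2 [a3 ga]]].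
move=> /(characteristic_matrixE w' p_prime stH)[b1 [b2 [b3 gb]]].
(* An isomorphism carries the generators of G to H, so that w and w' become matrices of the same
   group H. *)
apply/negP=> /gen_rows_isog/(_ ga)[c1 [c2 [c3 gc]]]; apply: ww'.
apply: (listed_uniq p_prime eta_nonresidue lw lw').
exact: (gen_rows_relate p_prime m_gt0 m2_lt_m1 m2_gt1 stH gc gb).
Qed.
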